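(* Let $d\ge 2$, let $\Lambda$ be a non-atomic, locally finite measure on the space $\mathcal H$ of affine hyperplanes in $\mathbb R^d$, let $W\subset\mathbb R^d$ be a compact convex set with positive volume, and let $t>0$. Let $Y(t\Lambda,W)$ be the random tessellation of $W$ obtained by the continuous-time cell-splitting construction driven by $\Lambda$ up to time $t$, and let $\mathrm{PHT}(t\Lambda,W)$ be the restriction to $W$ of the Poisson hyperplane tessellation with intensity measure $t\Lambda$. Define the cell intensity measures $$\mathbb M^{Y(t\Lambda,W)}:=\mathbb E\sum_{c\in\mathrm{Cells}(Y(t\Lambda,W))}\delta_c,\qquad \mathbb M^{\mathrm{PHT}(t\Lambda,W)}:=\mathbb E\sum_{c\in\mathrm{Cells}(\mathrm{PHT}(t\Lambda,W))}\delta_c .$$ Then $$\mathbb M^{Y(t\Lambda,W)}=\mathbb M^{\mathrm{PHT}(t\Lambda,W)}.$$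
   Context: For a compact convex set $K$, $[K]:=\{H\in\mathcal H: H\cap K\ne\emptyset\}$. A measure $\Lambda$ on $\mathcal H$ is locally finite if $\Lambda([K])<\infty$ for every compact convex $K$, and non-atomic if $\Lambda(\{H\})=0$ for every $H\in\mathcal H$. $\delta_c$ is the unit mass Dirac measure at $c$; the measures $\mathbb M$ are Borel measures on the space of closed subsets of $W$ (with the Fell topology). Cell-splitting construction: at time $0$ the only cell is $W$. Each cell $c$, when it is born, is assigned an exponentially distributed lifetime with parameter $\Lambda([c])$, independently of everything else given $c$. When its lifetime expires, a random hyperplane $H$ with law $\Lambda(\cdot\cap[c])/\Lambda([c])$ is drawn independently, and $c$ is replaced by the two cells $c^{\pm}(H)=c\cap H^{\pm}$, where $H^\pm$ are the two closed half-spaces bounded by $H$. (If $H$ misses the interior of $c$, then $c$ is left unchanged and receives a new lifetime.) The new cells receive independent lifetimes and the construction continues recursively until the deterministic time $t$. $\mathrm{Cells}(Y(t\Lambda,W))$ is the (a.s. finite) family of cells present at time $t$, and $Y(t\Lambda,W)$ is identified with the closed set formed by the union of the cell boundaries. $\mathrm{PHT}(t\Lambda,W)$: let $\eta$ be a Poisson point process on $\mathcal H$ with intensity measure $t\Lambda$. $\mathrm{Cells}(\mathrm{PHT}(t\Lambda,W))$ is the family of closures of the connected components of $\operatorname{int}(W)\setminus\bigcup_{H\in\eta}H$. *)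

(* Defs.v *)
From HB Require Import structures.
From mathcomp Require Import all_boot all_order all_algebra.
From mathcomp Require Import all_classical all_reals all_analysis.
From mathcomp Require Import measurable_realfun.
Set Implicit Arguments.
Unset Strict Implicit.
Unset Printing Implicit Defensive.
Import Order.TTheory GRing.Theory Num.Theory.
Import numFieldNormedType.Exports.
Local Open Scope classical_set_scope.
Local Open Scope ring_scope.

Section fell.
Variable E : topologicalType.

Record closed_set := ClosedSet {
  cset :> set E;
  closed_cset : closed cset }.

HB.instance Definition _ := gen_eqMixin closed_set.
HB.instance Definition _ := gen_choiceMixin closed_set.

(* The Fell topology: a subbase is given by the sets of closed F missing a
   compact K (index (true, K)) and of closed F hitting an open G (index
   (false, G)). *)
HB.instance Definition _ := @isSubBaseTopological.Build closed_set
  (bool * set E)%type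
  [set j | if j.1 then compact j.2 else open j.2]
  (fun j => if j.1 then [set F : closed_set | F `&` j.2 = set0]
            else [set F : closed_set | F `&` j.2 !=set0]).

(* As a [set_type], it carries the topology induced by the Fell topology. *)
Definition closed_subset (W : set E) : Type :=
  [set F : closed_set | F `<=` W].

HB.instance Definition _ W := Topological.on (closed_subset W).

End fell.

Section hyperplanes.
Variables (R : realType) (n : nat).
Local Notation E := 'rV[R]_n.+1.
Implicit Types (u x : E) (r : R) (c K : set E).

Definition dot u x : R := \sum_i u 0 i * x 0 i.

Definition is_hyperplane (F : closed_set E) : Prop :=
  exists u r, u != 0 /\ F = [set x | dot u x = r] :> set E.

Definition hyperplane_sub : Type := [set F : closed_set E | is_hyperplane F].

Lemma closed_coord0 : closed [set x : E | x 0 0 = 0].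
Proof.
rewrite (_ : [set _ | _] = (fun x : E => x 0 0) @^-1` [set 0])//.
apply: preimage_closed; last exact: closed_eq.
by move=> x _; exact: coord_continuous.
Qed.

Lemma is_hyperplane_coord0 : is_hyperplane (ClosedSet closed_coord0).
Proof.
exists (delta_mx 0 0), 0; split.
  by apply/eqP => /rowP/(_ 0)/eqP; rewrite !mxE !eqxx/= oner_eq0.
apply/seteqP; split => x /=; rewrite /dot (bigD1 ord0)//= big1 ?mxE ?eqxx/=.
- by rewrite mul1r addr0.
- by move=> i /negbTE i0; rewrite mxE i0 andbF mul0r.
- by rewrite mul1r addr0.
- by move=> i /negbTE i0; rewrite mxE i0 andbF mul0r.
Qed.

HB.instance Definition _ := Topological.on hyperplane_sub.
HB.instance Definition _ := isPointed.Build hyperplane_sub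
  (@exist _ _ (ClosedSet closed_coord0) (mem_set is_hyperplane_coord0)).

(* The affine hyperplanes, with the Borel sigma-algebra of the Fell topology. *)
Definition hyperplane := g_sigma_algebraType (@open hyperplane_sub).

HB.instance Definition _ := Measurable.on hyperplane.

Definition hset (H : hyperplane) : set E := sval (H : hyperplane_sub).

Definition hits K : set hyperplane := [set H | hset H `&` K !=set0].

(* To make the labels +/- of the two half-spaces a measurable function of H,
   H is oriented by its normal vectors whose first nonzero coordinate is
   positive. *)
Definition positive_normal (H : hyperplane) u r : Prop :=
  (exists2 i, 0 < u 0 i & forall j : 'I_n.+1, (j < i)%N -> u 0 j = 0) /\
  hset H = [set x | dot u x = r].

Definition halfspace (b : bool) (H : hyperplane) : set E :=
  [set x | exists u r, positive_normal H u r /\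
                       (if b then r <= dot u x else dot u x <= r)].

Definition non_atomic (Lambda : set hyperplane -> \bar R) : Prop :=
  forall H : hyperplane, Lambda [set H] = 0%E.

Definition locally_finite (Lambda : set hyperplane -> \bar R) : Prop :=
  forall K, compact K -> convex_set K -> (Lambda (hits K) < +oo)%E.

(* Lebesgue (outer) measure, by countable covers with boxes. *)
Definition volume (A : set E) : \bar R := ereal_inf
  [set v | exists a b : nat -> E,
    [/\ forall k i, a k 0 i <= b k 0 i,
        A `<=` \bigcup_k [set x | forall i, a k 0 i <= x 0 i <= b k 0 i]
      & v = (\sum_(0 <= k <oo) (\prod_i (b k 0 i - a k 0 i))%:E)%E]].

Section intensity.
Context d (Omega : measurableType d) (P : probability Omega R).

(* The measure E (sum_(i in D) delta_(c i)), for a random family of cells c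
   indexed by the random set D, on the space of closed subsets of W.  Its values
   are meant for Borel sets B; the image of B makes it a set of subsets of E,
   so that no proof that the cells are closed is needed here. *)
Definition cell_intensity (W : set E) (I : choiceType) (D : Omega -> set I)
    (c : Omega -> I -> set E) (B : set (closed_subset W)) : \bar R :=
  (\int[P]_w \esum_(i in D w)
     (\1_((fun F : closed_subset W => cset (sval F)) @` B) (c w i))%:E)%E.

End intensity.

(* The cells are labelled by finite binary words, most recent split first: the
   children of the cell labelled v are labelled true :: v (for c^+) and
   false :: v (for c^-).  When the hyperplane of v misses the interior, the
   cell goes on under the label true :: v, with the new lifetime attached to
   this label, and false :: v labels no cell. *)
Section cell_splitting.
Local Open Scope ereal_scope.
Variable W : set E.

Section outcome.
Variables (life : seq bool -> \bar R) (cut : seq bool -> hyperplane).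

Fixpoint cell (v : seq bool) : option (set E) :=
  if v is b :: u then
    if cell u is Some c then
      if `[< hset (cut u) `&` interior c !=set0 >]
      then Some (c `&` halfspace b (cut u))
      else if b then Some c else None
    else None
  else Some W.

Fixpoint birth (v : seq bool) : \bar R :=
  if v is _ :: u then birth u + life u else 0.

Definition present (t : R) : set (seq bool) :=
  [set v | [/\ cell v : bool, birth v <= t%:E & t%:E < birth v + life v]].

End outcome.

(* Exponential law on [0, +oo]; for the parameter 0 the lifetime is infinite. *)
Definition lifetime_law (rate : R) (B : set (\bar R)) : \bar R :=
  if (0 < rate)%R then exponential_prob rate (EFin @^-1` B) else \d_(+oo) B.

Context d (Omega : measurableType d) (P : probability Omega R).
Variable Lambda : {measure set hyperplane -> \bar R}.
Variables (life : seq bool -> Omega -> \bar R)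
          (cut : seq bool -> Omega -> hyperplane).

Definition cell_at (v : seq bool) (w : Omega) : option (set E) :=
  cell (cut^~ w) v.

(* Events determined by the lifetimes and hyperplanes of all labels other than
   v and its descendants; in particular the cell labelled v is so determined. *)
Definition elsewhere_gen (v : seq bool) : set (set Omega) :=
  [set A | exists2 u, ~~ suffix v u &
    preimage_set_system setT (life u) measurable A \/
    preimage_set_system setT (cut u) measurable A].

Definition elsewhere (v : seq bool) : set (set Omega) :=
  <<s elsewhere_gen v >>.

Definition elsewhere_or_life (v : seq bool) : set (set Omega) :=
  <<s elsewhere_gen v `|` preimage_set_system setT (life v) measurable >>.

(* Both laws are stated as conditional laws, integrated over the events of the
   conditioning sigma-algebra: given everything else, the lifetime of a
   cell c is exponential of parameter Lambda [c]; given everything else and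
   this lifetime, if it is finite, the hyperplane has law
   Lambda (. `&` [c]) / Lambda [c]. *)
Record cell_splitting : Prop := CellSplitting {
  measurable_life : forall v, measurable_fun setT (life v);
  measurable_cut : forall v, measurable_fun setT (cut v);
  life_law : forall v A B, elsewhere v A -> measurable B ->
    P (A `&` [set w | cell_at v w] `&` life v @^-1` B) =
    \int[P]_(w in A) (if cell_at v w is Some c
                      then lifetime_law (fine (Lambda (hits c))) B else 0);
  cut_law : forall v A D, elsewhere_or_life v A -> measurable D ->
    P (A `&` [set w | cell_at v w] `&` [set w | life v w < +oo]
         `&` cut v @^-1` D) =
    \int[P]_(w in A `&` [set w | life v w < +oo])
      (if cell_at v w is Some c
       then (fine (Lambda (D `&` hits c)) / fine (Lambda (hits c)))%:E else 0)
}.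

(* The cell intensity measure of Y(t Lambda, W). *)
Definition Y_intensity (t : R) : set (closed_subset W) -> \bar R :=
  cell_intensity P (fun w => present (life^~ w) (cut^~ w) t)
    (fun w v => odflt set0 (cell_at v w)).

End cell_splitting.

Section poisson.
Local Open Scope ereal_scope.
Context d (Omega : measurableType d) (P : probability Omega R).

(* A point process is given by the random multiplicities of its points. *)
Variable eta : Omega -> hyperplane -> nat.

Definition npoints (B : set hyperplane) (w : Omega) : \bar R :=
  \esum_(H in B) (eta w H)%:R%:E.

(* The second argument of [poisson_prob] is a dummy. *)
Record poisson_process (mu : set hyperplane -> \bar R) : Prop :=
  PoissonProcess {
  measurable_npoints : forall B, measurable B ->
    measurable_fun setT (npoints B);
  npoints_poisson : forall B k, measurable B -> mu B < +oo ->
    P [set w | npoints B w = k%:R%:E] =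
    poisson_prob (fine (mu B)) 0%N [set k];
  npoints_infinite : forall B, measurable B -> mu B = +oo ->
    P [set w | npoints B w = +oo] = 1;
  npoints_independent : forall m (B : 'I_m -> set hyperplane)
      (S : 'I_m -> set (\bar R)),
    (forall i, measurable (B i)) -> (forall i, measurable (S i)) ->
    trivIset setT B ->
    P (\bigcap_i (npoints (B i) @^-1` S i)) =
    \prod_i P (npoints (B i) @^-1` S i)
}.

Definition PHT_components (W : set E) (w : Omega) : set (set E) :=
  let U := interior W `\` \bigcup_(H in [set H | (0 < eta w H)%N]) hset H in
  connected_component U @` U.

(* The cell intensity measure of PHT(mu, W), for eta of intensity mu. *)
Definition PHT_intensity (W : set E) : set (closed_subset W) -> \bar R :=
  cell_intensity P (PHT_components W) (fun _ C => closure C).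

End poisson.

End hyperplanes.

(* Main.v *)
Require Import Defs.
From HB Require Import structures.
From mathcomp Require Import all_boot all_order all_algebra.
From mathcomp Require Import finmap.
From mathcomp Require Import all_classical all_reals all_analysis.
From mathcomp Require Import measurable_realfun.
From mathcomp Require Import ring lra.
Set Implicit Arguments.
Unset Strict Implicit.
Unset Printing Implicit Defensive.
Import Order.TTheory GRing.Theory Num.Theory.
Import numFieldNormedType.Exports.
Local Open Scope classical_set_scope.
Local Open Scope ring_scope.

(** Let S be a finite non-empty set of points and let [hits_hull S] be the set of
    hyperplanes meeting its convex hull.  In either tessellation the interiors of
    the cells are disjoint, so at most one cell has S in its interior, and the
    proof computes the probability that there is one:
<<
      exp (- t Lambda (hits_hull S))  if S is in the interior of W, 0 otherwise.
>>
    These numbers determine the intensity measures: the sets of cells with given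
    rational points in their interiors form a pi-system, and since the cells are
    closed and are the closures of their interiors, every Borel set of closed
    subsets of W corresponds to a set of the sigma-algebra generated by this
    pi-system ([measurable_trace_cell], [trace_cellP], [enumerated_unique]).

    For the Poisson tessellation the probability is the void probability of
    [hits_hull S]: two points of int W are in the same cell if and only if no hyperplane
    of the process meets the segment between them ([componentP], [void_prob],
    [pcell_total]).

    For the splitting construction, consider the cell c having S in its interior.
    It splits at rate Lambda [c], and its hyperplane separates S with probability
    Lambda (hits_hull S) / Lambda [c], so that S gets separated at the rate
    kappa = Lambda (hits_hull S), whatever c is.  To make this precise, let
<<
      surv v = E (exp (- kappa (t - birth v)); birth v <= t, S in the cell v).
>>
    Integrating out the lifetime and the hyperplane of v, which have known laws
    given everything else, one finds
<<
      surv v = P (v is present at time t, S in the cell v)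
               + surv (true :: v) + surv (false :: v)
>>
    ([clock_survival], [survival_step]).  Summed over all labels this telescopes
    to surv of the root, which is exp (- kappa t) ([sum_presence]), provided that
    the contribution of generation N tends to 0.  It does because the expectation
    of exp (- birth v), summed over the cells v of one generation around S, is
    multiplied from each generation to the next by at most a / (a + 1), where
    a = Lambda [W] ([clock_discount], [discount_step]).

    The measurability of all the events involved is obtained by testing interiors
    at the points of a dense sequence; a convex set W of positive volume has an
    interior because the part of a hyperplane in a bounded region can be covered by
    boxes of arbitrarily small total volume ([flat_volume]). *)

(** * Convex bodies and hyperplanes *)

Section geometry.
Variables (R : realType) (n : nat).
Local Notation E := 'rV[R]_n.+1.
Implicit Types (u x y z : E) (r s : R) (c A : set E).

Definition segment x y : set E := [set x + s *: (y - x) | s in `[0, 1]%classic].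

Lemma segment0 x y : segment x y x.
Proof. by exists 0; rewrite ?scale0r ?addr0//= in_itv/= lexx ler01. Qed.

Lemma segment1 x y : segment x y y.
Proof. by exists 1; rewrite ?scale1r ?subrKC//= in_itv/= lexx ler01. Qed.

Lemma conv_segment x y (l : {i01 R}) :
  conv l (x : convex_lmodType E) (y : convex_lmodType E) =
  y + l%:num *: (x - y) :> E.
Proof.
have -> : conv l (x : convex_lmodType E) (y : convex_lmodType E) =
  (l%:num *: x + (1 - l%:num) *: y) :> E by [].
by apply/rowP => i; rewrite !mxE; ring.
Qed.

Lemma convex_setP c :
  convex_set c <-> forall x y, c x -> c y -> segment x y `<=` c.
Proof.
split=> [cc x y cx cy _ [s /= + <-]|cc x y l].
  rewrite in_itv/= => /andP[s0 s1].
  have := cc y x (Itv01 s0 s1); rewrite !inE => /(_ cy cx).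
  by rewrite conv_segment.
rewrite !inE conv_segment => cx cy; apply: (cc y x cy cx); exists l%:num => //=.
by rewrite in_itv/= ge0 le1.
Qed.

Lemma dotDr u x y : dot u (x + y) = dot u x + dot u y.
Proof. by rewrite /dot -big_split/=; apply: eq_bigr => i _; rewrite mxE mulrDr. Qed.

Lemma dotZr u r x : dot u (r *: x) = r * dot u x.
Proof. by rewrite /dot mulr_sumr; apply: eq_bigr => i _; rewrite mxE mulrCA. Qed.

Lemma dotNr u x : dot u (- x) = - dot u x.
Proof. by rewrite -scaleN1r dotZr mulN1r. Qed.

Lemma dotC u x : dot u x = dot x u.
Proof. by apply: eq_bigr => i _; rewrite mulrC. Qed.

Lemma dotZl u r x : dot (r *: u) x = r * dot u x.
Proof. by rewrite dotC dotZr dotC. Qed.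

Lemma dot_delta u i : dot u (delta_mx 0 i) = u 0 i.
Proof.
rewrite /dot (bigD1 i)//= big1 ?mxE ?eqxx ?mulr1 ?addr0// => j ji.
by rewrite mxE (negbTE ji) andbF mulr0.
Qed.

Lemma dot_gt0 u : u != 0 -> 0 < dot u u.
Proof.
move=> u0; have [i ui] : exists i, u 0 i != 0.
  apply/existsP; apply: contraNT u0; rewrite negb_exists => /forallP u0.
  by apply/eqP/rowP => i; rewrite mxE; apply/eqP; have := u0 i; rewrite negbK.
rewrite /dot (bigD1 i)//= ltr_wpDr//; first by apply: sumr_ge0 => j _; rewrite -expr2 sqr_ge0.
by rewrite -expr2 exprn_even_gt0.
Qed.

Lemma dot_segment u x y s :
  dot u (x + s *: (y - x)) = (1 - s) * dot u x + s * dot u y.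
Proof. by rewrite dotDr dotZr dotDr dotNr; ring. Qed.

Lemma dot_continuous u : continuous (dot u).
Proof.
apply: continuous_big => [|i _ x]; first exact: add_continuous.
by apply: (@continuousM R E (fun=> u 0 i) (fun x => x 0 i)); [exact: cst_continuous|exact: coord_continuous].
Qed.

Lemma lt_half_open u r : open [set x | dot u x < r].
Proof.
rewrite (_ : [set _ | _] = dot u @^-1` [set s | s < r])//.
by apply: open_comp; [move=> x _; exact: dot_continuous|exact: open_lt].
Qed.

Lemma le_half_closed u r : closed [set x | dot u x <= r].
Proof.
rewrite (_ : [set _ | _] = dot u @^-1` [set s | s <= r])//.
by apply: preimage_closed; [move=> x _; exact: dot_continuous|exact: closed_le].
Qed.

Lemma near_line x v A : nbhs x A -> \forall s \near (0 : R), A (x + s *: v).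
Proof.
move=> xA; have h : (fun s : R => x + s *: v) @ (0 : R) --> x.
  rewrite -[X in _ --> X]addr0 -(scale0r v).
  by apply: cvgD; [exact: cvg_cst|apply: cvgZr_tmp; exact: cvg_id].
exact: h.
Qed.

Lemma near_line_gt0 x v A : nbhs x A -> exists2 s, 0 < s & A (x + s *: v) /\ A (x - s *: v).
Proof.
move=> xA; have := near_line v xA; have := near_line (- v) xA.
move=> /nbhs_ballP[e e0 He] /nbhs_ballP[f f0 Hf].
have m0 : 0 < Num.min e f / 2 by rewrite divr_gt0// lt_min e0.
exists (Num.min e f / 2) => //; split; last rewrite -scalerN.
- apply: Hf; rewrite /ball/= sub0r normrN gtr0_norm//.
  have : Num.min e f <= f by rewrite ge_min lexx orbT.
  lra.
- apply: He; rewrite /ball/= sub0r normrN gtr0_norm//.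
  have : Num.min e f <= e by rewrite ge_min lexx.
  lra.
Qed.

Lemma interior_le_half u r : u != 0 ->
  interior [set x | dot u x <= r] = [set x | dot u x < r].
Proof.
move=> u0; apply/seteqP; split=> x.
  move=> /near_line_gt0 => /(_ u)[s s0 [/= + _]].
  rewrite dotDr dotZr; have := dot_gt0 u0.
  move=> h; have := mulr_gt0 s0 h; lra.
move=> xr; rewrite /interior/=; apply: (filterS (P := [set x | dot u x < r])).
  by move=> y /= /ltW.
by apply: open_nbhs_nbhs; split => //; exact: lt_half_open.
Qed.

(** The homothety of centre y and ratio 1 - s maps c into itself and maps a
    neighbourhood of x onto a neighbourhood of the point in question. *)
Lemma interior_segment c x y s : convex_set c -> interior c x -> c y ->
  0 <= s < 1 -> interior c (x + s *: (y - x)).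
Proof.
move=> /convex_setP cc ix cy /andP[s0 s1]; set z : E := x + _.
have s10 : 1 - s != 0 by rewrite subr_eq0 eq_sym lt_eqF.
have h : (fun z' : E => x + (1 - s)^-1 *: (z' - z)) @ z --> x.
  rewrite -[X in _ --> X]addr0 -(scaler0 _ (1 - s)^-1) -(subrr z).
  apply: (@cvgD R E _ (nbhs z) _ (fun=> x)); first exact: cvg_cst.
  apply: (@cvgZl_tmp R E _ (nbhs z) _ _ (fun z' => z' - z)).
  by apply: (@cvgB R E _ (nbhs z) _ id (fun=> z)); [exact: cvg_id|exact: cvg_cst].
have : \forall z' \near z, c (x + (1 - s)^-1 *: (z' - z)) by exact: h.
rewrite /interior/=; apply: filterS => z' cz'.
apply: (cc _ _ cz' cy); exists s; first by rewrite /= in_itv/= s0 ltW.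
by rewrite /z; apply/rowP => i; rewrite !mxE; field.
Qed.

Lemma convex_interior c : convex_set c -> convex_set (interior c).
Proof.
move=> cc; apply/convex_setP => x y ix iy _ [s /= + <-].
rewrite in_itv/= => /andP[s0]; rewrite le_eqVlt => /predU1P[->|s1].
  by rewrite scale1r subrKC.
apply: interior_segment => //; last by rewrite s0.
exact: interior_subset.
Qed.

(** A point of c is the limit of the points of a segment joining it to an interior
    point, and those are interior by [interior_segment]. *)
Lemma convex_closure_interior c : convex_set c -> interior c !=set0 ->
  c `<=` closure (interior c).
Proof.
move=> cc [x ix] y cy A /(near_line (x - y)) /nbhs_ballP[e /= e0 He].
pose s := Num.min (e / 2) 1.
have s0 : 0 < s by rewrite lt_min divr_gt0//=.
have s1 : s <= 1 by rewrite ge_min lexx orbT.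
have se : s < e by rewrite gt_min; apply/orP; left; lra.
exists (y + s *: (x - y)); split; last first.
  by apply: He; rewrite /ball/= sub0r normrN gtr0_norm.
have -> : y + s *: (x - y) = x + (1 - s) *: (y - x).
  by apply/rowP => i; rewrite !mxE; ring.
by apply: interior_segment => //; lra.
Qed.

Lemma hyperplane_normal (H : hyperplane R n) : exists u r, positive_normal H u r.
Proof.
have [u [r [u0 Hur]]] := set_mem (valP (H : hyperplane_sub R n)).
have [i0 ui0] : exists i, u 0 i != 0.
  apply/existsP; apply: contraNT u0; rewrite negb_exists => /forallP u0.
  by apply/eqP/rowP => i; rewrite mxE; apply/eqP; have := u0 i; rewrite negbK.
case: (@arg_minnP _ i0 (fun i => u 0 i != 0) (fun i => i) ui0) => i ui imin.
exists (Num.sg (u 0 i) *: u), (Num.sg (u 0 i) * r); split.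
  exists i => [|j ji]; first by rewrite mxE -normrEsg normr_gt0.
  rewrite mxE; apply/eqP; rewrite mulf_eq0; apply/orP; right.
  by apply: contraTT ji => /imin; rewrite -leqNgt.
rewrite /hset Hur; apply/seteqP; split=> x /=; rewrite dotZl; first by move->.
by apply: mulfI; rewrite sgr_eq0.
Qed.

Lemma positive_normal_neq0 (H : hyperplane R n) u r : positive_normal H u r -> u != 0.
Proof. by move=> [[i ui _] _]; apply: contraTneq ui => ->; rewrite mxE ltxx. Qed.

(** Two normals of the same hyperplane are proportional, and the sign convention
    makes the factor positive, so that half-spaces may be computed with any of them. *)
Lemma positive_normal_unique (H : hyperplane R n) u r u' r' :
  positive_normal H u r -> positive_normal H u' r' ->
  exists2 a, 0 < a & u' = a *: u /\ r' = a * r.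
Proof.
move=> pn; have u0 := positive_normal_neq0 pn; move: pn.
move=> [[i ui ulti] Hur] [[j uj ultj] Hur'].
have uu := dot_gt0 u0; have uu0 : dot u u != 0 by rewrite gt_eqF.
pose x0 := (r / dot u u) *: u.
have ux0 : dot u x0 = r by rewrite dotZr; field.
have onH x : dot u x = r -> dot u' x = r'.
  move=> uxr; have : hset H x by rewrite Hur.
  by rewrite Hur'.
have u'x0 := onH _ ux0.
have orth z : dot u z = 0 -> dot u' z = 0.
  move=> uz; have := onH (x0 + z).
  rewrite !dotDr ux0 u'x0 uz addr0 => /(_ erefl) /eqP.
  by rewrite -subr_eq0 addrC addKr => /eqP.
pose a := dot u' u / dot u u.
have u'E : u' = a *: u.
  apply/eqP; rewrite -subr_eq0; apply/negPn/negP => /dot_gt0.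
  set z := u' - _.
  have uz : dot u z = 0 by rewrite dotDr dotNr dotZr /a (dotC u u'); field.
  rewrite (_ : dot z z = dot u' z - a * dot u z).
    by rewrite uz orth// mulr0 subrr ltxx.
  by rewrite dotC {2}/z dotDr dotNr dotZr !(dotC z).
exists a; last by split => //; rewrite -u'x0 {1}u'E dotZl ux0.
have u'k k : u' 0 k = a * u 0 k by rewrite u'E mxE.
have := uj; rewrite u'k; have [ij|ji|/val_inj ij] := ltngtP i j.
- by have := ultj _ ij; rewrite u'k => /eqP; rewrite mulf_eq0 (gt_eqF ui) orbF => /eqP ->; rewrite mul0r ltxx.
- by rewrite ulti// mulr0 ltxx.
by rewrite -ij pmulr_lgt0.
Qed.

Lemma halfspaceE (b : bool) (H : hyperplane R n) u r : positive_normal H u r ->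
  halfspace b H = [set x | if b then r <= dot u x else dot u x <= r].
Proof.
move=> pn; apply/seteqP; split=> x; last by exists u, r.
move=> [u' [r' [/(positive_normal_unique pn)[a a0 [-> ->]]]]].
by rewrite dotZl; case: b; rewrite ler_pM2l.
Qed.

Lemma sideE (b : bool) (H : hyperplane R n) u r : positive_normal H u r ->
  interior (halfspace b H) = [set x | if b then r < dot u x else dot u x < r].
Proof.
move=> pn; have u0 := positive_normal_neq0 pn; rewrite (halfspaceE _ pn).
case: b; last exact: interior_le_half.
have E1 : [set x | r <= dot u x] = [set x | dot (-1 *: u) x <= - r].
  by apply/seteqP; split=> x /=; rewrite dotZl mulN1r lerN2.
rewrite E1 interior_le_half; last by rewrite scaleN1r oppr_eq0.
by apply/seteqP; split=> x /=; rewrite dotZl mulN1r ltrN2.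
Qed.

Lemma halfspace_closed b (H : hyperplane R n) : closed (halfspace b H).
Proof.
have [u [r pn]] := hyperplane_normal H; rewrite (halfspaceE _ pn).
case: b; last exact: le_half_closed.
have -> : [set x | r <= dot u x] = [set x | dot (-1 *: u) x <= - r].
  by apply/seteqP; split=> x /=; rewrite dotZl mulN1r lerN2.
exact: le_half_closed.
Qed.

Lemma halfspace_convex b (H : hyperplane R n) : convex_set (halfspace b H).
Proof.
have [u [r pn]] := hyperplane_normal H; rewrite (halfspaceE _ pn).
apply/convex_setP => x y /= xr yr _ [s /= + <-].
rewrite in_itv/= dot_segment => /andP[s0 s1].
by case: b xr yr; nra.
Qed.

(** The affine function dot u - r has no zero on a segment exactly when it has the
    same strict sign at both end points. *)
Lemma hits_segmentP (H : hyperplane R n) u r x y : positive_normal H u r ->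
  hits (segment x y) H <-> (dot u x - r) * (dot u y - r) <= 0.
Proof.
move=> [_ Hur]; rewrite /hits/= Hur; split.
  move=> [w [/= + [s /= s01 ws]]]; move: s01; rewrite -ws.
  rewrite in_itv/= dot_segment => /andP[s0 s1] h.
  rewrite -h (_ : _ * _ = - (s * (1 - s) * (dot u x - dot u y) ^+ 2)); last by ring.
  by rewrite oppr_le0 mulr_ge0 ?sqr_ge0// mulr_ge0// subr_ge0.
move=> h; set a := dot u x in h; set b := dot u y in h.
have [ab|ab] := eqVneq a b.
  by exists x; split; [rewrite /= -/a; nra|exact: segment0].
exists (x + ((r - a) / (b - a)) *: (y - x)); split.
  rewrite /= dot_segment -/a -/b; field.
  by rewrite subr_eq0 eq_sym.
exists ((r - a) / (b - a)) => //=; rewrite in_itv/=.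
have [{}ab|{}ab|] := ltgtP a b; last by move/eqP; rewrite (negbTE ab).
- by rewrite divr_ge0 ?ler_pdivrMr ?subr_gt0 ?subr_ge0//=; nra.
- rewrite -mulrNN -invrN !opprB divr_ge0 ?ler_pdivrMr ?subr_gt0 ?subr_ge0//=; nra.
Qed.

Lemma hits_segment1 (H : hyperplane R n) x : hits (segment x x) H <-> hset H x.
Proof.
have [u [r pn]] := hyperplane_normal H; split.
  move/(hits_segmentP _ _ pn); case: pn => _ -> /=; nra.
by move=> Hx; exists x; split => //; exact: segment0.
Qed.

Lemma side_nhits b (H : hyperplane R n) x y : interior (halfspace b H) x ->
  interior (halfspace b H) y -> ~ hits (segment x y) H.
Proof.
have [u [r pn]] := hyperplane_normal H; rewrite (sideE _ pn) => + + /(hits_segmentP _ _ pn).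
by case: b => /=; nra.
Qed.

Lemma side_nhits_trans b (H : hyperplane R n) x y : interior (halfspace b H) x ->
  ~ hits (segment x y) H -> interior (halfspace b H) y.
Proof.
have [u [r pn]] := hyperplane_normal H; rewrite (sideE _ pn).
move=> xb; rewrite (hits_segmentP _ _ pn) => /negP; rewrite -ltNge.
by case: b xb => /=; nra.
Qed.

Lemma side_exists (H : hyperplane R n) x : ~ hset H x ->
  exists b, interior (halfspace b H) x.
Proof.
have [u [r pn]] := hyperplane_normal H; have [_ ->] := pn => /= /eqP.
by rewrite neq_lt => /orP[]; [exists false|exists true]; rewrite (sideE _ pn).
Qed.

Lemma side_unique (H : hyperplane R n) x b b' : interior (halfspace b H) x ->
  interior (halfspace b' H) x -> b = b'.
Proof.
have [u [r pn]] := hyperplane_normal H; rewrite !(sideE _ pn).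
by case: b b' => -[]//=; lra.
Qed.

(** This is why a hyperplane meeting the interior of a convex body cuts it into two
    bodies with non-empty interiors. *)
Lemma near_hyperplane (H : hyperplane R n) x A b : hset H x -> nbhs x A ->
  exists2 y, A y & interior (halfspace b H) y.
Proof.
have [u [r pn]] := hyperplane_normal H => Hx.
have := dot_gt0 (positive_normal_neq0 pn) => uu.
move=> /near_line_gt0 => /(_ u)[s s0 [As AsN]].
rewrite (sideE _ pn); case: pn => _ Hur; move: Hx; rewrite Hur/= => xr.
have su := mulr_gt0 s0 uu.
case: b; [exists (x + s *: u)|exists (x - s *: u)] => //=;
 rewrite dotDr ?dotNr dotZr xr; lra.
Qed.

Definition convex_body c := [/\ closed c, convex_set c & interior c !=set0].

Lemma convex_body_split b (H : hyperplane R n) c : convex_body c ->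
  hset H `&` interior c !=set0 -> convex_body (c `&` halfspace b H).
Proof.
move=> [cc xc _] [x [Hx ix]]; split.
- by apply: closedI => //; exact: halfspace_closed.
- apply/convex_setP => y z [cy hy] [cz hz] w yzw; split.
    by move: yzw; move/convex_setP: xc; apply.
  by move: yzw; move: (@halfspace_convex b H) => /convex_setP; apply.
have [y iy hy] := near_hyperplane b Hx (open_nbhs_nbhs (conj (@open_interior _ c) ix)).
by exists y; rewrite interiorI.
Qed.

(** A hyperplane meets the convex hull of S if and only if it meets a segment
    between two points of S; the second condition involves finitely many compact
    sets. *)
Definition hits_hull (S : seq E) : set (hyperplane R n) :=
  [set H | exists x y, [/\ x \in S, y \in S & hits (segment x y) H]].

Lemma hits_hullPn S (H : hyperplane R n) : S != [::] ->
  (exists b, forall x, x \in S -> interior (halfspace b H) x) <-> ~ hits_hull S H.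
Proof.
case: S => // x0 S _; split.
  by move=> [b Sb] [x [y [xS yS]]]; apply: side_nhits; [exact: Sb xS|exact: Sb yS].
move=> nH; have x0S : x0 \in x0 :: S by rewrite mem_head.
have [b x0b] : exists b, interior (halfspace b H) x0.
  by apply: side_exists => /hits_segment1 h; apply: nH; exists x0, x0.
exists b => x xS; apply: side_nhits_trans x0b _ => h; apply: nH.
by exists x0, x.
Qed.

End geometry.

(** * Convex sets of positive volume have interior points *)

Section interior_of_positive_volume.
Variables (R : realType) (n : nat).
Local Notation E := 'rV[R]_n.+1.
Implicit Types (u x y z : E) (r s : R) (c A W : set E).

Lemma coord_le_norm x i : `|x 0 i| <= `|x|.
Proof.
have /mapP[j Hj ->] : `|x ord0 i| \in [seq `|x k.1 k.2| | k : 'I_1 * 'I_n.+1].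
  by apply/mapP; exists (ord0, i) => //=; rewrite mem_enum.
by rewrite [leRHS]/Num.norm /= mx_normrE; apply/bigmax_geP; right => /=; exists j.
Qed.

Lemma convex_comb W w (I : eqType) (s : seq I) (v : I -> E) (p : I -> R) :
  convex_set W -> W w -> (forall i, W (w + v i)) -> (forall i, 0 <= p i) ->
  \sum_(i <- s) p i <= 1 -> W (w + \sum_(i <- s) p i *: v i).
Proof.
move=> cW Ww Wv; elim: s p => [|i s ih] p p0; first by rewrite !big_nil addr0.
rewrite !big_cons => ps; have s0 : 0 <= \sum_(j <- s) p j by apply: sumr_ge0.
have [p1|p1] := eqVneq (p i) 1.
  have /eqP : \sum_(j <- s) p j = 0 by lra.
  rewrite psumr_eq0// => /allP sp0.
  rewrite (_ : \sum_(j <- s) _ = 0) ?addr0 ?p1 ?scale1r//.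
  by rewrite big_seq big1// => j js; rewrite (eqP (sp0 _ js)) scale0r.
have p1' : 0 < 1 - p i by rewrite subr_gt0 lt_neqAle p1/=; lra.
have {}ih : W (w + \sum_(j <- s) (p j / (1 - p i)) *: v j).
  apply: ih => [j|]; first by rewrite divr_ge0// ltW.
  by rewrite -mulr_suml ler_pdivrMr//; lra.
move/convex_setP : cW => /(_ _ _ ih (Wv i)); apply; exists (p i).
  by rewrite /= in_itv/= p0; lra.
have -> : \sum_(j <- s) (p j / (1 - p i)) *: v j =
    (1 - p i)^-1 *: \sum_(j <- s) p j *: v j.
  by rewrite scaler_sumr; apply: eq_bigr => j _; rewrite scalerA mulrC.
by apply/rowP => k; rewrite !mxE; field; rewrite gt_eqF.
Qed.

(** Otherwise there would be n + 1 linearly independent directions leading from w to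
    points of W, and the simplex that they span has interior points. *)
Lemma flat_convex W w : convex_set W -> W w -> interior W = set0 ->
  exists2 u, u != 0 & W `<=` [set x | dot u x = dot u w].
Proof.
move=> cW Ww W0; apply: contrapT => Hn.
have {}Hn u : u != 0 -> exists2 x, W x & dot u (x - w) != 0.
  move=> u0; apply: contrapT => Hu; apply: Hn; exists u => // x Wx/=.
  apply/eqP; rewrite -subr_eq0 -dotNr -dotDr; apply: contrapT => ux.
  by apply: Hu; exists x => //; apply/negP.
(* a vector orthogonal to k < n + 1 rows is not orthogonal to all of W - w, which
   yields one more row *)
have ex k : (k <= n.+1)%N -> exists A : 'M[R]_(k, n.+1),
    (forall i, W (w + row i A)) /\ row_free A.
  elim: k => [_|k ih kn].
    exists 0; split; first by case.
    by apply: inj_row_free => v _; apply/rowP; case.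
  have [A [WA fA]] := ih (ltnW kn).
  have : kermx A^T != 0.
    by rewrite kermx_eq0 -row_leq_rank mxrank_tr -ltnNge (leq_ltn_trans (rank_leq_row A)).
  case/rowV0Pn => u /sub_kermxP uA u0.
  have [x Wx ux] := Hn _ u0.
  exists (col_mx (x - w) A : 'M[R]_(1 + k, n.+1)); split.
    move=> i; have [j ->|j ->] := @split_ordP 1 k i.
      by have := rowKu j (x - w) A; rewrite row_id => ->; rewrite subrKC.
    by have := rowKd j (x - w) A => ->.
  apply: (inj_row_free (m := 1 + k)) => v.
  rewrite -[v]hsubmxK mul_row_col => h.
  have Au : A *m u^T = 0 by rewrite -[A]trmxK -trmx_mul uA trmx0.
  have : (lsubmx v *m (x - w) + rsubmx v *m A) *m u^T = 0 by rewrite h mul0mx.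
  rewrite mulmxDl -!mulmxA Au mulmx0 addr0 => /matrixP/(_ 0 0).
  rewrite !mxE big_ord1 !mxE.
  have -> : \sum_j (x - w) 0 j * u^T j 0 = dot u (x - w).
    by apply: eq_bigr => j _; rewrite [u^T _ _]mxE mulrC.
  move=> /eqP; rewrite mulf_eq0 (negbTE ux) orbF => /eqP v0.
  have lv0 : lsubmx v = 0 by apply/rowP => j; rewrite ord1 !mxE.
  move: h; rewrite lv0 mul0mx add0r => h.
  have -> : rsubmx v = 0 by apply: (row_free_inj fA); rewrite mul0mx.
  by rewrite row_mx0.
have [A [WA fA]] := ex _ (leqnn _).
have Au : A \in unitmx by rewrite -row_free_unit.
pose B := invmx A; pose q i := row i B^T.
have gE y i : (y *m B) 0 i = dot (q i) y.
  by rewrite mxE; apply: eq_bigr => j _; rewrite !mxE mulrC.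
(* w + y0 is the barycentre of the simplex with vertices w and w + row i A *)
pose c0 : R := n.+2%:R^-1.
have c00 : 0 < c0 by rewrite invr_gt0.
pose y0 := (const_mx c0 : E) *m A.
have y0E i : dot (q i) y0 = c0 by rewrite -gE /y0 -mulmxA mulmxV// mulmx1 mxE.
have inW y : (forall i, 0 < dot (q i) y) -> dot (\sum_i q i) y < 1 -> W (w + y).
  move=> ygt0 ylt1.
  have -> : y = \sum_i dot (q i) y *: row i A.
    rewrite -{1}[y]mulmx1 -(mulVmx Au) mulmxA mulmx_sum_row.
    by apply: eq_bigr => i _; rewrite gE.
  apply: convex_comb => //; first by move=> i; exact: ltW.
  suff -> : \sum_i dot (q i) y = dot (\sum_i q i) y by exact: ltW.
  rewrite [RHS]dotC; rewrite (big_morph (dot y) (dotDr y) (_ : dot y 0 = 0)).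
    by apply: eq_bigr => i _; rewrite dotC.
  by rewrite -(scale0r 0) dotZr mul0r.
pose z : E := w + y0; have zw : z - w = y0 by rewrite /z addrC addKr.
suff : interior W z by rewrite W0.
have sE : dot (\sum_i q i) y0 < 1.
  rewrite dotC (big_morph (dot y0) (dotDr y0) (_ : dot y0 0 = 0)); last first.
    by rewrite -(scale0r 0) dotZr mul0r.
  under eq_bigr do rewrite dotC y0E.
  rewrite sumr_const card_ord -mulr_natl ltr_pdivrMr ?mul1r ?ltr_nat//.
rewrite /interior/=.
have -> : W = [set x | W (w + (x - w))] by apply/seteqP; split=> x /=; rewrite subrKC.
have dxw u r : open [set x | dot u (x - w) < r].
  rewrite (_ : [set _ | _] = [set x | dot u x < r + dot u w]); first exact: lt_half_open.
  by apply/seteqP; split=> x /=; rewrite dotDr dotNr ltrBlDr.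
have n1 : \forall x \near z, dot (\sum_i q i) (x - w) < 1.
  by apply: (open_nbhs_nbhs (conj (dxw _ _) _)); rewrite /= zw.
have n2 : \forall x \near z, forall i, 0 < dot (q i) (x - w).
  apply: (@filter_forall E _ (fun i x => 0 < dot (q i) (x - w)) (nbhs z) (nbhs_filter z)) => i.
  have := @open_nbhs_nbhs _ z _ (conj (dxw (-1 *: q i) 0) _).
  rewrite /= zw dotZl y0E mulN1r oppr_lt0 => /(_ c00).
  by apply: filterS => x; rewrite /= dotZl mulN1r oppr_lt0.
by near=> x; apply: inW; [near: x|near: x].
Unshelve. all: by end_near. Qed.

Lemma unit_cell N (z : R) : (0 < N)%N -> 0 <= z <= N%:R ->
  exists2 k : 'I_N, k%:R <= z & z <= k.+1%:R.
Proof.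
case: N => // N _; elim: N => [|N ih] /andP[z0 zN].
  by exists ord0.
have [zN1|zN1] := leP z N.+1%:R.
  have [|k k1 k2] := ih _; first by rewrite z0.
  by exists (widen_ord (leqnSn _) k).
by exists ord_max => //; exact: ltW.
Qed.

Lemma volume_finite_cover W (I : finType) (a b : I -> E) (v : R) :
  (forall k i, a k 0 i <= b k 0 i) ->
  W `<=` \bigcup_k [set x | forall i, a k 0 i <= x 0 i <= b k 0 i] ->
  (forall k, \prod_i (b k 0 i - a k 0 i) = v) ->
  (volume W <= (#|I|%:R * v)%:E)%E.
Proof.
(* the finite family is completed to a sequence by boxes reduced to a point *)
move=> ab Wab abv; pose ext (f : I -> E) (k : nat) :=
  if insub k is Some i then f (enum_val (i : 'I_#|I|)) else 0.
have [I0|I0] := posnP #|I|.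
  have -> : W = set0.
    by rewrite -subset0 => x /Wab[k _ _]; have /card0_eq/(_ k) := I0.
  rewrite I0 mul0r; apply: ereal_inf_lbound.
  exists (fun=> 0), (fun=> 0); split => //.
  by rewrite eseries0// => k _ _; rewrite big_ord_recl mxE subrr mul0r.
have /card_gt0P[i0 _] := I0.
have v0 : 0 <= v by rewrite -(abv i0) prodr_ge0// => i _; rewrite subr_ge0.
apply: (@le_trans _ _ (\sum_(0 <= k <oo)
    (\prod_i (ext b k 0 i - ext a k 0 i))%:E)%E).
  apply: ereal_inf_lbound; exists (ext a), (ext b); split => //.
    by move=> k i; rewrite /ext; case: insubP => [j _ _|_]; rewrite ?lexx.
  move=> x /Wab[k _ xk]; exists (enum_rank k) => //=; rewrite /ext.
  by rewrite valK enum_rankK.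
have E1 k : \prod_i (ext b k 0 i - ext a k 0 i) = if (k < #|I|)%N then v else 0.
  rewrite /ext; case: insubP => [j -> _|/negbTE ->]; first exact: abv.
  by rewrite big_ord_recl subrr mul0r.
under eq_eseriesr do rewrite E1.
apply: lime_le; first by apply: is_cvg_nneseries => k _ _; case: ifP.
apply: nearW => p; rewrite sumEFin lee_fin.
have -> : \sum_(0 <= k < p) (if (k < #|I|)%N then v else 0) = (minn p #|I|)%:R * v.
  elim: p => [|p ih]; first by rewrite big_nil min0n mul0r.
  rewrite big_nat_recr//= ih; case: ltnP => h.
    by rewrite (minn_idPl h) -natr1 mulrDl mul1r.
  by rewrite (minn_idPr (leqW h)) addr0.
by rewrite ler_wpM2r// ler_nat geq_minr.
Qed.

(** If u i <> 0, the flat is the graph of a Lipschitz function of the coordinates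
    other than i.  Cutting the range of these coordinates into N ^ n cubes of side
    2 M / N covers W by as many boxes of height 2 C / N, of total volume V / N. *)
Lemma flat_volume W u r : compact W -> u != 0 -> W `<=` [set x | dot u x = r] ->
  volume W = 0%E.
Proof.
move=> cW u0 Wu; apply/eqP; rewrite eq_le; apply/andP; split; last first.
  apply: le_ereal_inf_tmp => _ [a [b [ab _ ->]]]; apply: nneseries_ge0 => k _ _.
  by rewrite lee_fin prodr_ge0// => i _; rewrite subr_ge0.
have [i ui] : exists i, u 0 i != 0.
  apply/existsP; apply: contraNT u0; rewrite negb_exists => /forallP u0.
  by apply/eqP/rowP => i; rewrite mxE; apply/eqP; have := u0 i; rewrite negbK.
have [M [M0 WM]] : exists M : R, 0 < M /\ forall x j, W x -> `|x 0 j| <= M.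
  have [M [_ HM]] := compact_bounded cW; exists (`|M| + 1); split.
    by rewrite ltr_wpDl.
  move=> x j Wx; apply: le_trans (coord_le_norm _ _) _; apply: HM => //.
  by rewrite (le_lt_trans (ler_norm M))// ltrDl.
pose C : R := \sum_(k < n) `|u 0 (lift i k)| / `|u 0 i| * (2 * M).
have C0 : 0 <= C by apply: sumr_ge0 => k _; rewrite mulr_ge0 ?divr_ge0// mulr_ge0 ?ltW.
pose V : R := (2 * M) ^+ n * (2 * C).
have V0 : 0 <= V.
  by apply: mulr_ge0; [apply/exprn_ge0/mulr_ge0|apply: mulr_ge0] => //; exact: ltW.
suff key N : (0 < N)%N -> (volume W <= (V / N%:R)%:E)%E.
  apply/lee_addgt0Pr => e e0; rewrite add0e.
  pose N := (Num.truncn (V / e)).+1.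
  apply: le_trans (key N isT) _; rewrite lee_fin ler_pdivrMr// mulrC -ler_pdivrMr//.
  by rewrite ltW//; apply: truncnS_gt.
move=> N0; have N0' : 0 < N%:R :> R by rewrite ltr0n.
pose cell_lo (f : {ffun 'I_n -> 'I_N}) k : R := - M + 2 * M * (f k)%:R / N%:R.
pose g f : R := (r - \sum_(k < n) u 0 (lift i k) * cell_lo f k) / u 0 i.
pose a f : E := \row_j if unlift i j is Some k then cell_lo f k else g f - C / N%:R.
pose b f : E := \row_j if unlift i j is Some k then cell_lo f k + 2 * M / N%:R else g f + C / N%:R.
have := @volume_finite_cover W {ffun 'I_n -> 'I_N} a b ((2 * M / N%:R) ^+ n * (2 * (C / N%:R))).
rewrite card_ffun !card_ord => /(_ _ _ _)/le_trans; apply.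
- move=> f j; rewrite !mxE; case: unlift => [k|].
    by rewrite lerDl divr_ge0// ?mulr_ge0// ltW.
  by rewrite lerD2l (@le_trans _ _ 0)// ?oppr_le0 divr_ge0// ltW.
- move=> x Wx.
  have /choice[f fP] : forall k : 'I_n, exists m : 'I_N,
     m%:R <= (x 0 (lift i k) + M) * N%:R / (2 * M) <= m.+1%:R.
    move=> k; have := WM x (lift i k) Wx; rewrite ler_norml => /andP[xM1 xM2].
    have [|m m1 m2] := @unit_cell N ((x 0 (lift i k) + M) * N%:R / (2 * M)) N0.
      apply/andP; split; first by apply: divr_ge0; [apply: mulr_ge0 => //|]; lra.
      by rewrite ler_pdivrMr ?mulr_gt0// mulrC ler_pM2l//; lra.
    by exists m; rewrite m1.
  pose F : {ffun 'I_n -> 'I_N} := [ffun k => f k].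
  have FP k : cell_lo F k <= x 0 (lift i k) <= cell_lo F k + 2 * M / N%:R.
    have := fP k; rewrite /cell_lo ffunE.
    set m := f k; move=> /andP[]; rewrite ler_pdivlMr ?mulr_gt0// ler_pdivrMr ?mulr_gt0//.
    rewrite -[m.+1%:R]natr1 => h1 h2.
    have e1 : m%:R * (2 * M) / N%:R <= x 0 (lift i k) + M by rewrite ler_pdivrMr.
    have e2 : x 0 (lift i k) + M <= (m%:R + 1) * (2 * M) / N%:R by rewrite ler_pdivlMr.
    have -> : 2 * M * m%:R / N%:R = m%:R * (2 * M) / N%:R by field; rewrite gt_eqF.
    have e3 : (m%:R + 1) * (2 * M) / N%:R = m%:R * (2 * M) / N%:R + 2 * M / N%:R.
      by field; rewrite gt_eqF.
    by rewrite e3 in e2; lra.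
  exists F => // j; rewrite !mxE; case: unliftP => [k ->|->]; first exact: FP.
  have xE : x 0 i = (r - \sum_(k < n) u 0 (lift i k) * x 0 (lift i k)) / u 0 i.
    have := Wu _ Wx; rewrite /= /dot (bigD1_ord i)//= => <-.
    by field.
  suff : `|x 0 i - g F| <= C / N%:R by rewrite ler_distl.
  rewrite xE /g -mulrBl opprB addrC addrA subrK -sumrB normrM normfV.
  rewrite ler_pdivrMr ?normr_gt0//; apply: le_trans (ler_norm_sum _ _ _) _.
  rewrite /C !mulr_suml; apply: ler_sum => k _.
  rewrite -mulrBr normrM.
  have -> : `|u 0 (lift i k)| / `|u 0 i| * (2 * M) / N%:R * `|u 0 i| =
     `|u 0 (lift i k)| * (2 * M / N%:R).
    by field; rewrite normr_eq0 ui gt_eqF.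
  rewrite ler_wpM2l// distrC; have /andP[h1 h2] := FP k.
  by rewrite ger0_norm ?subr_ge0// lerBlDl.
- move=> f; rewrite (bigD1_ord i)//= mulrC !mxE unlift_none; congr (_ * _).
    under eq_bigr => k _ do rewrite !mxE liftK addrC addKr.
    by rewrite prodr_const card_ord.
  by ring.
rewrite lee_fin natrX le_eqVlt; apply/orP; left; apply/eqP.
rewrite /V expr_div_n; field; rewrite expf_eq0 gt_eqF// andbF.
by [].
Qed.

Lemma positive_volume_interior W : compact W -> convex_set W ->
  (0 < volume W)%E -> interior W !=set0.
Proof.
move=> cW xW vW; apply/set0P/negP => /eqP W0.
have [WE|/set0P[w Ww]] := eqVneq W set0; last first.
  have [u u0 Wu] := flat_convex xW Ww W0.
  by move: vW; rewrite (flat_volume cW u0 Wu) ltxx.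
have u0 : delta_mx 0 0 != 0 :> E.
  by apply/eqP => /rowP/(_ 0)/eqP; rewrite !mxE !eqxx oner_eq0.
by move: vW; rewrite (@flat_volume _ _ 0 cW u0) ?ltxx// WE.
Qed.

End interior_of_positive_volume.

(** * Measurability of events about a random hyperplane *)

Section dense_points.
Variables (R : realType) (n : nat).
Local Notation E := 'rV[R]_n.+1.
Implicit Types (x y : E).

(** Sealed in a sigma type because density is all that matters about the points. *)
Lemma dense_sequence :
  {f : nat -> E | forall A : set E, open A -> A !=set0 -> exists k, A (f k)}.
Proof.
exists (fun k => if (choice.unpickle k : option 'rV[rat]_n.+1) is Some v then map_mx ratr v else 0).
move=> A oA [x Ax]; have := open_nbhs_nbhs (conj oA Ax).
move=> /nbhs_ballP[e /= e0 He].
have /choice[f fP] : forall i : 'I_n.+1, exists q : rat, `|x 0 i - ratr q| < e.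
  move=> i; have [|q] := @rat_in_itvoo R (x 0 i - e) (x 0 i + e).
    by rewrite ltrBlDr -addrA ltrDl addr_gt0.
  by rewrite in_itv/= => /andP[h1 h2]; exists q; rewrite ltr_distlC; apply/andP.
exists (choice.pickle (\row_i f i : 'rV[rat]_n.+1)); rewrite choice.pickleK.
apply: He; split => // i j; rewrite ord1 /ball/= !mxE; exact: fP.
Qed.

Definition rational_point : nat -> E := sval dense_sequence.

Lemma rational_point_dense (A : set E) :
  open A -> A !=set0 -> exists k, A (rational_point k).
Proof. exact: (svalP dense_sequence). Qed.

Lemma segment_continuous x y : continuous (fun s : R => x + s *: (y - x)).
Proof.
move=> s; apply: (@cvgD R E _ (nbhs s) _ (fun=> x)); first exact: cvg_cst.
by apply: cvgZr_tmp; exact: cvg_id.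
Qed.

Lemma connected_segment x y : connected (segment x y).
Proof.
apply: connected_continuous_connected; first exact: segment_connected.
by apply: continuous_subspaceT => s; exact: segment_continuous.
Qed.

Lemma compact_segment x y : compact (segment x y).
Proof.
apply: continuous_compact; last exact: segment_compact.
by apply: continuous_subspaceT => s; exact: segment_continuous.
Qed.

End dense_points.

Section fell_topology.
Variables (E : topologicalType).

Definition fell_subbase (j : bool * set E) : set (closed_set E) :=
  if j.1 then [set F : closed_set E | F `&` j.2 = set0]
  else [set F : closed_set E | F `&` j.2 !=set0].

Lemma fell_openP (O : set (closed_set E)) (F : closed_set E) : open O -> O F ->
  exists js : seq (bool * set E),
    [/\ forall j, j \in js -> if j.1 then compact j.2 else open j.2,
        forall j, j \in js -> fell_subbase j F &
        forall F', (forall j, j \in js -> fell_subbase j F') -> O F'].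
Proof.
move=> [D' DO <-] [A DA AF].
have [js jsD AE] := DO _ DA.
exists (enum_fset js); split.
- by move=> j /jsD /set_mem.
- by move=> j jj; move: AF; rewrite -AE => /(_ j); apply.
- by move=> F' jF'; exists A => //; change (A F'); rewrite -AE => j jj; exact: jF'.
Qed.

Lemma fell_subbase_open j : (if j.1 then compact j.2 else open j.2) ->
  open (fell_subbase j).
Proof.
move=> hj; exists [set fell_subbase j]; last by rewrite bigcup_set1.
move=> _ ->; exists [fset j]%fset; first by move=> k; rewrite in_fset1 => /eqP ->; exact: mem_set.
apply/seteqP; split=> F; first by move/(_ j); apply; rewrite /= in_fset1.
by move=> jF k; rewrite /= in_fset1 => /eqP ->.
Qed.

End fell_topology.

Section measurable_hits.
Variables (R : realType) (n : nat).
Local Notation E := 'rV[R]_n.+1.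
Local Notation HH := (hyperplane R n).

Lemma measurable_hits_open (G : set E) : open G -> measurable (hits G : set HH).
Proof.
move=> oG; apply: sub_sigma_algebra.
by exists (fell_subbase (false, G)) => //; exact: fell_subbase_open.
Qed.

Lemma measurable_hits_compact (K : set E) : compact K -> measurable (hits K : set HH).
Proof.
move=> cK; rewrite -[hits K]setCK; apply: measurableC; apply: sub_sigma_algebra.
exists (fell_subbase (true, K)); first exact: fell_subbase_open.
apply/seteqP; split=> H.
  by move=> /= h [x]; rewrite /fell_subbase/= in h; rewrite -[_ x]/((_ `&` _) x) h.
by move=> h; rewrite /fell_subbase/=; apply/eqP/negPn/negP => /set0P.
Qed.

Lemma measurable_hits_segment (x y : E) : measurable (hits (segment x y) : set HH).
Proof. by apply: measurable_hits_compact; exact: compact_segment. Qed.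

Lemma measurable_hset (x : E) : measurable [set H : HH | hset H x].
Proof.
rewrite (_ : [set _ | _] = hits (segment x x)); first exact: measurable_hits_segment.
by apply/seteqP; split=> H /hits_segment1.
Qed.

Lemma hits_hull_seq (S : seq E) : hits_hull S =
  \bigcup_(p in [set` [seq (x, y) | x <- S, y <- S]]) hits (segment p.1 p.2) :> set HH.
Proof.
apply/seteqP; split=> H.
  move=> [x [y [xS yS xyH]]]; exists (x, y) => //=.
  by apply/allpairsP; exists (x, y).
by move=> [p /= /allpairsP[[x y]/= [xS yS ->]] h]; exists x, y.
Qed.

Lemma measurable_hits_hull (S : seq E) : measurable (hits_hull S : set HH).
Proof.
rewrite hits_hull_seq; apply: fin_bigcup_measurable => // p _.
exact: measurable_hits_segment.
Qed.

(** Test the side of x by rays issued from x.  The first coordinate axis along which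
    the line through x meets H is that of the first non-zero coordinate of the normal,
    which is positive; so x is strictly below H if and only if the ray in the positive
    direction of this axis meets H. *)
Lemma measurable_side b (x : E) :
  measurable [set H : HH | interior (halfspace b H) x].
Proof.
pose e (i : 'I_n.+1) : E := delta_mx 0 i.
pose ray i s : set HH := \bigcup_k hits (segment x (x + (s * k%:R) *: e i)).
have mray i s : measurable (ray i s).
  by apply: bigcupT_measurable => k; exact: measurable_hits_segment.
pose sgn : R := if b then -1 else 1.
rewrite (_ : [set _ | _] = ~` [set H : HH | hset H x] `&`
   \bigcup_(i in [set: 'I_n.+1]) (ray i sgn `\`
     \bigcup_(j in [set j : 'I_n.+1 | (j < i)%N]) (ray j 1 `|` ray j (-1)))).
  apply: measurableI; first by apply: measurableC; exact: measurable_hset.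
  apply: fin_bigcup_measurable; first exact: finite_finset.
  move=> i _; apply: measurableD => //.
  apply: fin_bigcup_measurable; first exact: finite_finset.
  by move=> j _; exact: measurableU.
apply/seteqP; split=> H; have [u [r pn]] := hyperplane_normal H;
  have [[i0 ui0 ulti] Hur] := pn; rewrite /= (sideE _ pn);
  set a : R := dot u x - r.
all: have sideA : (if b then r < dot u x else dot u x < r) <-> sgn * a < 0.
1,3: by rewrite /sgn /a; case: (b); [rewrite mulN1r oppr_lt0 subr_gt0|rewrite mul1r subr_lt0].
all: have rayP i s : s ^+ 2 = 1 -> ray i s H <->
       exists k : nat, (s * a) * (s * a + k%:R * u 0 i) <= 0.
1,3: move=> s1; have E1 (k : nat) : (s * a) * (s * a + k%:R * u 0 i) =
         a * (a + (s * k%:R) * u 0 i).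
1,3: rewrite [LHS](_ : _ = s ^+ 2 * (a * a) + a * ((s * k%:R) * u 0 i)); last (by ring);
       rewrite s1; ring.
1,2: split; [move=> [k _ /(hits_segmentP _ _ pn) h]; exists k; rewrite E1|
      move=> [k]; rewrite E1 => h; exists k => //; apply/(hits_segmentP _ _ pn)];
    by move: h; rewrite dotDr dotZr dot_delta addrAC.
all: have archi (c : R) : exists k : nat, 0 <= c + k%:R * u 0 i0.
1,3: exists (Num.truncn (- c / u 0 i0)).+1; rewrite -lerBlDl sub0r -ler_pdivrMr// ltW//;
  exact: truncnS_gt.
all: have sgn2 : sgn ^+ 2 = 1 by rewrite /sgn; case: (b); rewrite ?sqrrN expr1n.
- move=> /sideA; set t := sgn * a => t0.
  have a0 : a != 0 by apply: contraTneq t0; rewrite /t => ->; rewrite mulr0 ltxx.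
  split; first by rewrite Hur/=; apply/eqP; rewrite -subr_eq0.
  exists i0 => //; split.
    apply/rayP => //; rewrite -/t; have [k hk] := archi t; exists k.
    by rewrite nmulr_rle0.
  move=> [j /= ji []]; (rewrite rayP ?sqrrN ?expr1n//) => -[k];
    rewrite (ulti _ ji) mulr0 addr0 -expr2 leNgt exprn_even_gt0//;
    by rewrite ?mulN1r ?oppr_eq0 ?mul1r a0.
- move=> [nH [i _ [/rayP-/(_ sgn2)[k] + nray]]].
  move=> tk; apply/sideA; move: tk; set t := sgn * a.
  have t0 : t != 0.
    rewrite mulf_neq0//; first by rewrite -sqrf_eq0 sgn2 oner_eq0.
    by apply/eqP => a0; apply: nH; rewrite Hur/=; apply/eqP; rewrite -subr_eq0 -/a a0.
  have [ii0|ii0|/val_inj ->] := ltngtP i i0.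
  + by rewrite (ulti _ ii0) mulr0 addr0 -expr2 leNgt exprn_even_gt0//= t0.
  + move=> _; exfalso; apply: nray; exists i0 => //.
    have [ta|ta] := ltP a 0; [left|right]; (apply/rayP; first by rewrite ?sqrrN expr1n).
      by have [k' hk] := archi a; exists k'; rewrite mul1r nmulr_rle0.
    have [k' hk] := archi (- a); exists k'.
    by rewrite mulN1r mulNr oppr_le0 mulr_ge0.
  + move=> tk; rewrite ltNge; apply/negP => t0'.
    have {}t0 : 0 < t by rewrite lt_neqAle eq_sym t0.
    move: tk; rewrite leNgt => /negP; apply; rewrite mulr_gt0// ltr_wpDr//.
    by rewrite mulr_ge0// ltW.
Qed.

End measurable_hits.

(** * A sigma-algebra on cells *)

Lemma cset_inj (E : topologicalType) : injective (@cset E).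
Proof.
by move=> [F cF] [G cG] /= FG; rewrite FG in cF *; congr ClosedSet; exact: Prop_irrelevance.
Qed.

Section cell_space.
Variables (R : realType) (n : nat).
Local Notation E := 'rV[R]_n.+1.
Local Notation Q := (@rational_point R n).

Definition cylinder (ks : seq nat) : set (set E) :=
  [set c | forall k, k \in ks -> interior c (Q k)].

(** The two extra members make the family cover the space while remaining stable
    under intersection; cells have interior points, so neither has any mass. *)
Definition cylinders : set (set (set E)) :=
  [set A | (exists2 ks, ks != [::] & A = cylinder ks) \/
           A = set0 \/ A = [set c | forall k, ~ interior c (Q k)]].

(** All sets of points are admitted, so that cells which fail to exist can be
    encoded by the empty set. *)
Definition cell_space := g_sigma_algebraType cylinders.
HB.instance Definition _ := Measurable.on cell_space.

Lemma cylinders_setI : setI_closed cylinders.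
Proof.
have H0 ks : ks != [::] -> cylinder ks `&` [set c | forall k, ~ interior c (Q k)] = set0.
  case: ks => // k ks _; rewrite -subset0 => c [ck nc]; apply: (nc k).
  by apply: ck; rewrite mem_head.
move=> A B [[ks k0 ->]|[->|->]] [[ks' k0' ->]|[->|->]]; rewrite ?set0I ?setI0 ?H0//;
  try by right; left.
- left; exists (ks ++ ks'); first by case: (ks) k0.
  apply/seteqP; split=> c.
    by move=> [h1 h2] k; rewrite mem_cat => /orP[/h1|/h2].
  by move=> h; split=> k kk; apply: h; rewrite mem_cat kk ?orbT.
- by rewrite setIC H0//; right; left.
- by rewrite setIid; right; right.
Qed.

Lemma measurable_cylinder ks : measurable (cylinder ks : set cell_space).
Proof.
case: ks => [|k ks].
  by rewrite (_ : cylinder [::] = setT)//; apply/seteqP; split=> // c _ k; rewrite inE.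
by apply: sub_sigma_algebra; left; exists (k :: ks).
Qed.

Lemma measurable_interior_at k : measurable [set c : cell_space | interior c (Q k)].
Proof.
rewrite (_ : [set _ | _] = cylinder [:: k]); first exact: measurable_cylinder.
apply/seteqP; split=> c; first by move=> ck j; rewrite inE => /eqP ->.
by move/(_ k); apply; rewrite mem_head.
Qed.

Lemma measurable_fun_cell_space d (T : measurableType d) (f : T -> cell_space) :
  (forall k, measurable [set w | interior (f w : set E) (Q k)]) -> measurable_fun setT f.
Proof.
move=> mf; apply: (@measurability _ _ T cell_space setT f cylinders) => //.
have mcyl ks : measurable (f @^-1` cylinder ks).
  rewrite (_ : _ @^-1` _ = \bigcap_(k in [set` ks]) [set w | interior (f w : set E) (Q k)])//.
  exact: fin_bigcap_measurable.
move=> _ [A [[ks _ ->]|[->|->]] <-]; rewrite setTI ?preimage_set0//.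
rewrite (_ : _ @^-1` _ = ~` \bigcup_k [set w | interior (f w : set E) (Q k)]).
  by apply: measurableC; exact: bigcupT_measurable.
apply/seteqP; split=> w /=; first by move=> h [k _]; exact: h.
by move=> h k hk; apply: h; exists k.
Qed.

Section borel.
Variable W : set E.
Hypothesis cW : closed W.

(** A map to closed subsets of W that can be computed from the rational points in
    the interior, and that fixes the closed subsets of W which are the closures of
    their interiors. *)
Definition trace (c : set E) : set E :=
  closure [set x | exists k, [/\ interior c (Q k), W (Q k) & x = Q k]].

Lemma trace_sub c : trace c `<=` W.
Proof.
rewrite [W in X in _ `<=` X](_ : W = closure W); last exact/closure_id.
by apply: closure_subset => _ [k [_ Wk ->]].
Qed.

Lemma traceE c : closed c -> c `<=` closure (interior c) -> c `<=` W -> trace c = c.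
Proof.
move=> cc cic cWc; apply/seteqP; split.
  rewrite [c in X in _ `<=` X](_ : c = closure c); last exact/closure_id.
  by apply: closure_subset => _ [k [/interior_subset ck _ ->]].
move=> x /cic cx A xA; have [y [cy Ay]] := cx (interior A) (nbhs_interior xA).
have [k [ck Ak]] : exists k, (interior c `&` interior A) (Q k).
  apply: rational_point_dense; last by exists y.
  by apply: openI; exact: open_interior.
exists (Q k); split; last exact: interior_subset.
by exists k; split => //; apply: cWc; exact: interior_subset.
Qed.

Definition trace_cell (c : cell_space) : closed_subset W :=
  exist _ (ClosedSet (@closed_closure _ _)) (mem_set (@trace_sub c)).

Definition rational_ball (l : nat * nat) : set E := ball (Q l.1) l.2.+1%:R^-1.

Lemma rational_ball_open l : open (rational_ball l).
Proof. exact: ball_open. Qed.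

Lemma rational_ball_nbhs x A : nbhs x A ->
  exists l, rational_ball l x /\ rational_ball l `<=` A.
Proof.
move=> /nbhs_ballP[e /= e0 He].
pose m := Num.truncn (2 / e).
have m0 : 0 < m.+1%:R^-1 :> R by rewrite invr_gt0.
have [k xk] : exists k, ball x m.+1%:R^-1 (Q k).
  apply: rational_point_dense; first exact: ball_open.
  by exists x; exact: ballxx.
exists (k, m); split; first exact: ball_sym.
move=> y ky; apply: He; apply: (@le_ball _ _ _ (m.+1%:R^-1 + m.+1%:R^-1)).
  have : 2 / e < m.+1%:R by exact: truncnS_gt.
  rewrite ltr_pdivrMr// => h.
  have -> : m.+1%:R^-1 + m.+1%:R^-1 = 2 / m.+1%:R :> R by ring.
  by rewrite ler_pdivrMr// mulrC ltW.
exact: ball_triangle xk ky.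
Qed.

(** The sets of F missing, or hitting, all the balls of a finite list of balls with
    rational centres and radii 1 / (m + 1).  There are countably many, and the Fell
    open sets are unions of finite intersections of them. *)
Definition code_set (e : bool * seq (nat * nat)) : set (closed_subset W) :=
  [set F | forall l, l \in e.2 ->
    if e.1 then ~ (cset (sval F) `&` rational_ball l !=set0)
    else cset (sval F) `&` rational_ball l !=set0].

(** A compact set disjoint from F is covered by finitely many of the rational balls
    that are disjoint from F. *)
Lemma code_set_nbhs j (F : closed_subset W) :
  (if j.1 then compact j.2 else open j.2) -> fell_subbase j (sval F) ->
  exists2 e, code_set e F & forall F', code_set e F' -> fell_subbase j (sval F').
Proof.
case: j => -[] K /=; rewrite /fell_subbase/=.
  rewrite compact_cover => cK FK.
  pose D : set (nat * nat) := [set l | ~ (cset (sval F) `&` rational_ball l !=set0)].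
  have [||D' D'D KD'] := cK _ D rational_ball.
  - by move=> l _; exact: rational_ball_open.
  - move=> x Kx; have : nbhs x (~` (cset (sval F))).
      apply: open_nbhs_nbhs; split; first exact/closed_openC/(@closed_cset _ (sval F)).
      by move=> Fx; have : set0 x by rewrite -FK.
    move=> /rational_ball_nbhs[l [lx lF]]; exists l => //= -[y [Fy ly]].
    exact: lF ly Fy.
  exists (true, enum_fset D').
    by move=> l /= /D'D /set_mem.
  move=> F' F'D'; rewrite -subset0 => x [F'x /KD'[l lD' lx]].
  by apply: (F'D' l lD'); exists x.
move=> oK [x [Fx Kx]].
have [l [lx lK]] := rational_ball_nbhs (open_nbhs_nbhs (conj oK Kx)).
exists (false, [:: l]); first by move=> l' /=; rewrite inE => /eqP ->; exists x.
move=> F' /(_ l)/=; rewrite mem_head => /(_ isT)[y [F'y ly]].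
by exists y; split => //; exact: lK.
Qed.

Definition codes_set (m : seq (bool * seq (nat * nat))) : set (closed_subset W) :=
  [set F | forall e, e \in m -> code_set e F].

Lemma open_codesE (O : set (closed_subset W)) : open O ->
  O = \bigcup_(m in [set m | codes_set m `<=` O]) codes_set m.
Proof.
move=> [V oV <-]; apply/seteqP; split=> F; last by move=> [m mO Fm]; exact: mO.
move=> VF; have [js [js1 js2 js3]] := fell_openP oV VF.
have : exists2 m, codes_set m F & forall F', codes_set m F' ->
    forall j, j \in js -> fell_subbase j (sval F').
  elim: js js1 js2 {js3} => [|j js ih] js1 js2; first by exists [::].
  have [||m mF mjs] := ih.
  - by move=> k kj; apply: js1; rewrite inE kj orbT.
  - by move=> k kj; apply: js2; rewrite inE kj orbT.
  have [||e eF ej] := @code_set_nbhs j F.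
  - by apply: js1; rewrite mem_head.
  - by apply: js2; rewrite mem_head.
  exists (e :: m); first by move=> e'; rewrite inE => /predU1P[->//|]; exact: mF.
  move=> F' F'm k; rewrite inE => /predU1P[->|kj].
    by apply: ej; apply: F'm; rewrite mem_head.
  by apply: mjs kj => e' e'm; apply: F'm; rewrite inE e'm orbT.
move=> [m mF mO]; exists m => //= F' /mO; exact: js3.
Qed.

(** The Fell topology is second countable, and the trace of c hits an open ball if
    and only if some rational point of W in this ball is interior to c. *)
Lemma measurable_trace_cell (B : set (closed_subset W)) :
  <<s @open (closed_subset W) >> B -> measurable (trace_cell @^-1` B).
Proof.
have mhit l : measurable [set c : cell_space | trace c `&` rational_ball l !=set0].
  rewrite (_ : [set _ | _] = \bigcup_(k in [set k | W (Q k) /\ rational_ball l (Q k)])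
      [set c : cell_space | interior c (Q k)]).
    by apply: bigcup_measurable => k _; exact: measurable_interior_at.
  apply/seteqP; split=> c.
    move=> [x [cx lx]]; have [_ [[k [ck Wk ->]] lk]] :=
      cx _ (open_nbhs_nbhs (conj (@rational_ball_open l) lx)).
    by exists k.
  move=> [k [Wk lk] ck]; exists (Q k); split => //; apply: subset_closure.
  by exists k.
have mcode e : measurable (trace_cell @^-1` code_set e).
  case: e => b L; rewrite (_ : _ @^-1` _ = \bigcap_(l in [set` L])
    (if b then ~` [set c : cell_space | trace c `&` rational_ball l !=set0]
     else [set c : cell_space | trace c `&` rational_ball l !=set0])).
    apply: fin_bigcap_measurable => // l _; case: b => //; exact: measurableC.
  by apply/seteqP; split=> c h l /h; case: b {h}.
have mcodes m : measurable (trace_cell @^-1` codes_set m).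
  rewrite (_ : _ @^-1` _ = \bigcap_(e in [set` m]) (trace_cell @^-1` code_set e))//.
  exact: fin_bigcap_measurable.
pose S := image_set_system setT trace_cell (@measurable _ cell_space).
have SS : sigma_algebra setT S.
  exact/sigma_algebra_image/sigma_algebra_measurable.
suff /(smallest_sub SS) SB : @open (closed_subset W) `<=` S.
  by move=> /SB; rewrite /S /image_set_system/= setTI.
move=> O oO; rewrite /S /image_set_system/= setTI (open_codesE oO) preimage_bigcup.
rewrite (_ : \bigcup_(m in _) _ = \bigcup_m (if `[< codes_set m `<=` O >]
   then trace_cell @^-1` codes_set m else set0)).
  apply: countable_bigcupT_measurable; first exact: countableP.
  by move=> m; case: ifP.
apply/seteqP; split=> c.
  by move=> [m mO cm]; exists m => //; rewrite ifT//; apply/asboolP.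
by move=> [m _]; case: asboolP => // mO cm; exists m.
Qed.

Lemma trace_cellP (B : set (closed_subset W)) (c : set E) :
  closed c -> c `<=` closure (interior c) -> c `<=` W ->
  ((fun F : closed_subset W => cset (sval F)) @` B) c <-> (trace_cell @^-1` B) c.
Proof.
move=> cc cic cWc; have tc := traceE cc cic cWc; split.
  move=> [F BF Fc]; rewrite /preimage/= (_ : trace_cell c = F)//.
  by apply: val_inj; apply: cset_inj; rewrite Fc; exact: tc.
by move=> Bc; exists (trace_cell c).
Qed.

End borel.

Local Notation HH := (hyperplane R n).

(** For a compact c that is the closure of its interior, H meets c if and only if
    there are interior rational points of c at arbitrarily small distance from H.
    This form is measurable in the pair of c and H, which makes Lambda [c] a
    measurable function of c. *)
Definition hits_cell : set (cell_space * HH) :=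
  [set p | forall m : nat, exists k, interior p.1 (Q k) /\
                                  hits (ball (Q k) m.+1%:R^-1) p.2].

Lemma measurable_hits_cell : measurable hits_cell.
Proof.
rewrite (_ : hits_cell = \bigcap_m \bigcup_k
  ([set c : cell_space | interior c (Q k)] `*` hits (ball (Q k) m.+1%:R^-1))).
  apply: bigcapT_measurable => m; apply: bigcupT_measurable => k.
  apply: measurableX; first exact: measurable_interior_at.
  by apply: measurable_hits_open; exact: ball_open.
apply/seteqP; split=> -[c H] h m; first by move=> _; have [k ck] := h m; exists k.
by have [//|k _ ck] := h m; exists k.
Qed.

Lemma hits_cellE (c : set E) : compact c -> c `<=` closure (interior c) ->
  xsection hits_cell c = hits c.
Proof.
move=> cc cic; apply/seteqP; split=> H; rewrite xsectionP.
  move=> h; apply: contrapT => nH.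
  have /compact_near_coveringP ncc := cc.
  have := ncc nat \oo (fun m x => ~ hits (ball x m.+1%:R^-1) H) _.
  case=> [x cx|N _ HN].
    have : nbhs x (~` hset H).
      apply: open_nbhs_nbhs; split; first exact/closed_openC/(@closed_cset _ (sval (H : hyperplane_sub R n))).
      by move=> Hx; apply: nH; exists x.
    move=> /nbhs_ballP[e /= e0 He].
    exists (ball x (e / 2), [set m | (Num.truncn (2 / e) <= m)%N]).
      split; last by exists (Num.truncn (2 / e)).
      by apply: nbhsx_ballx; rewrite divr_gt0.
    move=> [y m] [/= xy em] [z [Hz yz]]; apply: (He z) => //.
    rewrite [e]splitr; apply: ball_triangle xy _.
    apply: le_ball yz; rewrite -(invrK (e / 2)) lef_pV2 ?posrE ?invr_gt0 ?divr_gt0//.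
    rewrite invf_div ltW// (lt_le_trans (truncnS_gt _))// ler_nat ltnS//.
  have [k [ck kH]] := h N; apply: (HN N _ (Q k)) => //=.
  exact: interior_subset.
move=> [x [Hx cx]] m.
have m0 : 0 < m.+1%:R^-1 :> R by rewrite invr_gt0.
have [y [cy xy]] := cic _ cx _ (nbhsx_ballx x _ m0).
have [k [ck xk]] : exists k, (interior c `&` ball x m.+1%:R^-1) (Q k).
  apply: rational_point_dense; last by exists y.
  by apply: openI; [exact: open_interior|exact: ball_open].
by exists k; split => //; exists x; split => //; exact: ball_sym.
Qed.
End cell_space.

(** * Intensity measures determined by cylinders *)

Definition image_measure d d' (T : measurableType d) (T' : measurableType d')
    (R : realType) (mu : {measure set T -> \bar R}) (f : T -> T')
    (mf : measurable_fun setT f) : {measure set T' -> \bar R} :=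
  @measure_function_pushforward__canonical__measure_function_Measure
    _ _ _ _ _ mu f mf.

Lemma esum_pickle (R : realType) (T : countType) (a : T -> \bar R) :
  (forall x, 0 <= a x)%E ->
  (\esum_(x in [set: T]) a x =
   \sum_(0 <= i <oo) oapp a 0 (pickle_inv i : option T))%E.
Proof.
move=> a0; rewrite nneseries_esumT; last by move=> i; case: pickle_inv.
have bij : set_bij [set: T] (range (@choice.pickle T)) (@choice.pickle T).
  by split; [move=> x _; exists x|move=> x y _ _; exact: (pcan_inj choice.pickleK)|].
transitivity (\esum_(i in range (@choice.pickle T)) oapp a 0%E (pickle_inv i : option T))%E.
  rewrite (@reindex_esum R _ _ _ _ _ _ bij); apply: eq_esum => x _.
  by rewrite pickleK_inv.
rewrite esum_mkcond; apply: eq_esum => i _; case: ifPn => // /negP ni.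
case e : (pickle_inv i : option T) => [x|]//=; exfalso; apply: ni; apply/mem_set; exists x => //.
by have := @pickle_invK T i; rewrite e.
Qed.

Section enumeration.
Local Open Scope ereal_scope.
Variables (R : realType) (n : nat) (W : set 'rV[R]_n.+1) (cW : closed W).
Local Notation Q := (@rational_point R n).

(** A presentation of an intensity measure by a sequence of random cells, the i-th
    of which exists on the event F i.  The expected number of cells having the points
    Q k, k in ks, in their interiors is value ks. *)
Definition enumerated d (Omega : measurableType d) (P : probability Omega R)
    (M : set (closed_subset W) -> \bar R) (value : seq nat -> R) : Prop :=
  exists (F : nat -> set Omega) (c : nat -> Omega -> cell_space R n),
  [/\ (forall i, measurable (F i)),
      (forall i, measurable_fun setT (c i)),
      (forall B, <<s @open (closed_subset W) >> B ->
        M B = \sum_(0 <= i <oo) P (F i `&` c i @^-1` (trace_cell cW @^-1` B))),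
      (forall ks, ks != [::] ->
        \sum_(0 <= i <oo) P (F i `&` c i @^-1` cylinder ks) = (value ks)%:E) &
      (forall i w, F i w -> exists k, interior (c i w) (Q k))].

Lemma enumerated_measure d (Omega : measurableType d) (P : probability Omega R)
    (F : nat -> set Omega) (c : nat -> Omega -> cell_space R n) :
  (forall i, measurable (F i)) -> (forall i, measurable_fun setT (c i)) ->
  exists mu : {measure set (cell_space R n) -> \bar R},
    forall A, mu A = \sum_(0 <= i <oo) P (F i `&` c i @^-1` A).
Proof.
move=> mF mc.
exists (mseries (fun i => image_measure (mrestr P (mF i)) (mc i)) 0%N) => A.
by apply: eq_eseriesr => i _; rewrite setIC.
Qed.

(** The cylinders form a pi-system generating the sigma-algebra of cells, and
    cells have interior points. *)
Lemma enumerated_unique d1 (Omega1 : measurableType d1) (P1 : probability Omega1 R)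
    d2 (Omega2 : measurableType d2) (P2 : probability Omega2 R)
    (M1 M2 : set (closed_subset W) -> \bar R) (value : seq nat -> R) :
  enumerated P1 M1 value -> enumerated P2 M2 value ->
  forall B, <<s @open (closed_subset W) >> B -> M1 B = M2 B.
Proof.
move=> [F1 [c1 [mF1 mc1 M1E cyl1 ne1]]] [F2 [c2 [mF2 mc2 M2E cyl2 ne2]]] B mB.
have [mu1 mu1E] := enumerated_measure P1 mF1 mc1.
have [mu2 mu2E] := enumerated_measure P2 mF2 mc2.
have void1 : mu1 [set c | forall k, ~ interior c (Q k)] = 0.
  rewrite mu1E eseries0// => i _ _; rewrite (_ : _ `&` _ = set0) ?measure0//.
  by apply/seteqP; split=> // w [/ne1[k Qk] /(_ k)].
have void2 : mu2 [set c | forall k, ~ interior c (Q k)] = 0.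
  rewrite mu2E eseries0// => i _ _; rewrite (_ : _ `&` _ = set0) ?measure0//.
  by apply/seteqP; split=> // w [/ne2[k Qk] /(_ k)].
rewrite M1E// M2E// -mu1E -mu2E.
apply: (@measure_unique _ R (cell_space R n) (@cylinders R n)
  (fun k => if k is k'.+1 then cylinder [:: k'] else [set c | forall k, ~ interior c (Q k)])).
- by [].
- exact: cylinders_setI.
- by case=> [|k]; [right; right|left; exists [:: k]].
- rewrite -subTset => c _; have [[k ck]|nc] := pselect (exists k, interior c (Q k)).
    by exists k.+1 => // j; rewrite inE => /eqP ->.
  by exists 0%N => // k ck; apply: nc; exists k.
- move=> _ [[ks ks0 ->]|[->|->]]; last by rewrite void1 void2.
    by rewrite mu1E mu2E cyl1// cyl2.
  by rewrite !measure0.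
- case=> [|k]; first by rewrite void1.
  by rewrite mu1E cyl1// ltry.
- exact: measurable_trace_cell.
Qed.

End enumeration.

(** * Exponential clocks *)

Section exponential_lifetimes.
Variable R : realType.
Local Open Scope ereal_scope.

Lemma exponential_prob_ray (rate x : R) : (0 < rate)%R ->
  exponential_prob rate `[x, +oo[ =
  (if (0 <= x)%R then expR (- rate * x) else 1%R)%:E.
Proof.
move=> r0.
have ge0 y : (0 <= y)%R ->
    exponential_prob rate `[y, +oo[ = (expR (- rate * y))%:E.
  move=> y0; rewrite /exponential_prob.
  rewrite (@ge0_continuous_FTC2y _ _ (fun x => - (expR (- rate * x)))%R _ 0%R)//.
  - by rewrite EFinN oppeK add0e.
  - by move=> z _; apply: exponential_pdf_ge0; exact: ltW.
  - apply: (@continuous_subspaceW R^o _ _ [set` `[0%R, +oo[]).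
      by apply: subset_itvr; rewrite bnd_simp.
    exact: within_continuous_exponential_pdf.
  - rewrite -oppr0; apply: cvgN.
    rewrite (_ : (fun x => expR (- rate * x))%R =
                 (fun z => expR (- z))%R \o (fun z => rate * z)%R); last first.
      by apply: eq_fun => z; rewrite mulNr.
    apply: (@cvg_comp _ _ _ _ _ _ (pinfty_nbhs R)); last exact: cvgr_expR.
    exact: gt0_cvgMry.
  - apply: cvgN; apply/cvg_at_right_filter.
    apply: continuous_comp; last exact: continuous_expR.
    by apply: (@continuousM R R^o) => //; exact: cst_continuous.
  - move=> z; rewrite in_itv/= andbT => yz; apply: derive1_exponential_pdf.
    by rewrite in_itv/= andbT (le_lt_trans y0).
case: leP => [/ge0//|x0]; apply/eqP.
pose m := exponential_distribution_exponential_prob__canonical__probability_measure_Probability r0.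
rewrite -[exponential_prob rate]/(m : set R -> \bar R) eq_le probability_le1//=.
have <- : m `[0%R, +oo[%classic = 1 by rewrite /= ge0// mulr0 expR0.
apply: (@le_measure _ _ _ m).
- by apply: mem_set; exact: measurable_itv.
- by apply: mem_set; exact: measurable_itv.
- by apply: subset_itvr; rewrite bnd_simp ltW.
Qed.

(** All lifetimes are rescalings of one exponential variable of parameter 1, so that
    a conditional exponential law of random parameter becomes an integral over a
    product space. *)
Definition exp1 : probability (measurableTypeR R) R :=
  exponential_distribution_exponential_prob__canonical__probability_measure_Probability (@ltr01 R).

Lemma exp1_scale (lam : R) (B : set R) : (0 < lam)%R -> measurable B ->
  exp1 [set y | B (y / lam)%R] = exponential_prob lam B.
Proof.
move=> l0 mB.
pose m := exponential_distribution_exponential_prob__canonical__probability_measure_Probability l0.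
have mf : measurable_fun setT (fun y : measurableTypeR R => (y / lam)%R : measurableTypeR R).
  exact: mulrr_measurable.
rewrite -[LHS]/(image_measure exp1 mf B) -[RHS]/(m B).
refine (@g_sigma_algebra_measure_unique _ R (measurableTypeR R) (@RGenCInfty.G R)
  _ (fun k => `[(- k%:R)%R, +oo[%classic) _ _ (image_measure exp1 mf) m _ _ _ B _).
- by move=> _ [x ->]; exact: measurable_itv.
- by move=> k; exists (- k%:R)%R.
- rewrite -subTset => x _; exists (Num.truncn `|x|).+1 => //=.
  rewrite in_itv/= andbT lerNl ltW// (le_lt_trans _ (truncnS_gt _))//.
  by rewrite -normrN ler_norm.
- move=> _ _ [x ->] [y ->]; exists (Num.max x y).
  by apply/seteqP; split=> z /=; rewrite !in_itv/= !andbT ge_max; [move=> [-> ->]|move/andP].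
- move=> _ [x ->]; rewrite /= /image_measure/= /pushforward/=.
  rewrite (_ : _ @^-1` _ = `[(x * lam)%R, +oo[%classic); last first.
    by apply/seteqP; split=> z /=; rewrite !in_itv/= !andbT ler_pdivlMr.
  rewrite !exponential_prob_ray// pmulr_lge0//.
  by rewrite mulN1r mulNr mulrC.
- move=> k; apply: (@le_lt_trans _ _ 1); last exact: ltry.
  apply: (@probability_le1 _ _ _ exp1); rewrite -[X in measurable X]setTI.
  by apply: mf => //; exact: measurable_itv.
- suff : (RGenCInfty.G (R:=R)).-sigma.-measurable B by [].
  by rewrite -RGenCInfty.measurableE.
Qed.

End exponential_lifetimes.

Section transfer.
Import HBNNSimple.
Local Open Scope ereal_scope.
Context d (T : measurableType d) (R : realType).

(** The simple functions approximating g express the integral by the weights of the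
    sets Z @^-1` B only. *)
Lemma integral_comp_weight d' (S : measurableType d') (P : {measure set S -> \bar R})
    (Z : S -> T) (f : S -> R) (g : T -> \bar R) (mg : measurable_fun setT g) :
  measurable_fun setT Z -> measurable_fun setT f -> (forall x, 0 <= f x)%R ->
  (forall x, 0 <= g x) ->
  \int[P]_x (g (Z x) * (f x)%:E) =
  limn (fun n => \sum_(y \in range (nnsfun_approx measurableT mg n))
    (y%:E * \int[P]_(x in Z @^-1` (nnsfun_approx measurableT mg n @^-1` [set y])) (f x)%:E)).
Proof.
move=> mZ mf f0 g0; have mf' : measurable_fun setT (EFin \o f) by exact/measurable_EFinP.
set w := nnsfun_approx measurableT mg.
have wZ n : measurable_fun setT (fun x => ((w n (Z x))%:E * (f x)%:E)).
  apply: emeasurable_funM => //; apply/measurable_EFinP.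
  by apply: measurableT_comp => //.
transitivity (limn (fun n => \int[P]_x ((w n (Z x))%:E * (f x)%:E))).
  rewrite -monotone_convergence//.
  - apply: eq_integral => x _; apply/esym/cvg_lim => //.
    by apply: cvgeMr => //; exact: cvg_nnsfun_approx.
  - by move=> n x _; rewrite mule_ge0// lee_fin.
  - move=> x _ a b ab; rewrite lee_wpmul2r ?lee_fin//.
    by have /lefP := nd_nnsfun_approx measurableT mg ab; exact.
apply/congr_lim/funext => n.
have mwn y : measurable (Z @^-1` (w n @^-1` [set y])).
  by rewrite -[X in measurable X]setTI; exact: mZ.
pose F y := (EFin \o f) \_ (Z @^-1` (w n @^-1` [set y])).
have F0 y x : 0 <= F y x by apply: erestrict_ge0 => z _; rewrite lee_fin.
have yF0 y x : 0 <= y%:E * F y x.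
  have [y0|y0] := leP 0%R y; first by rewrite mule_ge0.
  rewrite /F patchE memNset ?mule0//= => wy.
  by move: y0; rewrite -wy ltNge fun_ge0.
have mF y : measurable_fun setT (F y).
  by apply/(measurable_restrictT _ (mwn y)); exact: measurable_funTS mf'.
transitivity (\int[P]_x \sum_(y \in range (w n)) (y%:E * F y x)).
  apply: eq_integral => x _.
  rewrite (fimfunE (w n)) -fsumEFin// ge0_mule_fsuml.
    apply: eq_fsbigr => y _.
    by rewrite EFinM -muleA; congr (_ * _); rewrite /F epatch_indic muleC.
  by move=> y; rewrite EFinM; exact: nnfun_muleindic_ge0.
rewrite ge0_integral_fsum//.
- apply: eq_fsbigr => y /set_mem[t _ <-].
  rewrite ge0_integralZl//.
  + by rewrite -integral_mkcond.
  + by rewrite lee_fin.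
- by move=> y; exact: measurable_funeM.
Qed.

Lemma transfer_integral d1 d2 (S1 : measurableType d1) (S2 : measurableType d2)
    (P1 : {measure set S1 -> \bar R}) (P2 : {measure set S2 -> \bar R})
    (Z1 : S1 -> T) (Z2 : S2 -> T) (f1 : S1 -> R) (f2 : S2 -> R) (g : T -> \bar R) :
  measurable_fun setT Z1 -> measurable_fun setT Z2 ->
  measurable_fun setT f1 -> measurable_fun setT f2 ->
  (forall x, 0 <= f1 x)%R -> (forall x, 0 <= f2 x)%R ->
  (forall B, measurable B -> \int[P1]_(x in Z1 @^-1` B) (f1 x)%:E =
                             \int[P2]_(x in Z2 @^-1` B) (f2 x)%:E) ->
  measurable_fun setT g -> (forall x, 0 <= g x) ->
  \int[P1]_x (g (Z1 x) * (f1 x)%:E) = \int[P2]_x (g (Z2 x) * (f2 x)%:E).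
Proof.
move=> mZ1 mZ2 mf1 mf2 f10 f20 f12 mg g0.
rewrite !(integral_comp_weight _ mg)//.
by under eq_fun do under eq_fsbigr do rewrite f12//.
Qed.

End transfer.

Section clock.
Local Open Scope ereal_scope.
Variable R : realType.

Definition scaled_life (lam y : R) : \bar R :=
  if (0 < lam)%R then (y / lam)%:E else +oo.

Lemma lifetime_law_exp1 lam B : (0 <= lam)%R -> measurable B ->
  lifetime_law lam B = exp1 R [set y | B (scaled_life lam y)].
Proof.
move=> l0 mB; rewrite /lifetime_law /scaled_life; case: ifPn => [lp|_].
  rewrite -exp1_scale//.
  by rewrite -[X in measurable X]setTI; exact: EFin_measurable.
rewrite diracE; case: (boolP (+oo \in B)) => [/set_mem Boo|/negP Boo].
  rewrite (_ : [set y | _] = setT) ?probability_setT//.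
  by apply/seteqP; split.
rewrite (_ : [set y | _] = set0) ?measure0//.
by apply/seteqP; split => // x /mem_set.
Qed.

Lemma measurable_scaled_life d (T : measurableType d) (lam y : T -> R) :
  measurable_fun setT lam -> measurable_fun setT y ->
  measurable_fun setT (fun x => scaled_life (lam x) (y x)).
Proof.
move=> ml my; rewrite (_ : (fun _ => _) = fun x =>
  if (0 < lam x)%R then (y x * lam x `^ (-1))%:E else +oo); last first.
  apply/funext => x; rewrite /scaled_life; case: ifP => // lx.
  by rewrite powR_inv1// ltW.
apply: measurable_fun_ifT.
- exact: measurable_fun_ltr.
- apply/measurable_EFinP; apply: measurable_funM => //.
  exact: (measurableT_comp (measurable_powR _)).
- exact: measurable_cst.
Qed.

(** Conditionally on Z, the variable L may be replaced by an independent exponential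
    variable scaled by the parameter: both sides are integrals of g for measures on
    T * \bar R that agree on rectangles. *)
Lemma exponential_clock d (Omega : measurableType d) (P : probability Omega R)
    d' (T : measurableType d') (Z : Omega -> T) (lam : T -> R)
    (L : Omega -> \bar R) (A : set Omega) (g : T * \bar R -> \bar R) :
  measurable_fun setT Z -> measurable_fun setT lam -> (forall z, 0 <= lam z)%R ->
  measurable_fun setT L -> measurable A ->
  (forall B1 B2, measurable B1 -> measurable B2 ->
     P (A `&` Z @^-1` B1 `&` L @^-1` B2) =
     \int[P]_(w in A `&` Z @^-1` B1) lifetime_law (lam (Z w)) B2) ->
  measurable_fun setT g -> (forall p, 0 <= g p) ->
  \int[P]_(w in A) g (Z w, L w) =
  \int[P]_(w in A) \int[exp1 R]_y g (Z w, scaled_life (lam (Z w)) y).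
Proof.
move=> mZ ml l0 mL mA HL mg g0.
(* the image of P times exp1 by psi is compared with the law of (Z, L) *)
pose psi (p : Omega * measurableTypeR R) := (Z p.1, scaled_life (lam (Z p.1)) p.2).
have mpsi : measurable_fun setT psi.
  apply: measurable_fun_pair; first exact: measurableT_comp.
  apply: measurable_scaled_life => //.
  by apply: measurableT_comp => //; exact: measurableT_comp.
have mZL : measurable_fun setT (fun w => (Z w, L w)) by exact: measurable_fun_pair.
pose A2 : set (Omega * measurableTypeR R) := A `*` setT.
have mA2 : measurable A2 by exact: measurableX.
pose M1 := image_measure (mrestr P mA) mZL.
pose M2 := image_measure (mrestr (P \x exp1 R) mA2) mpsi.
have M12 B : measurable B -> M1 B = M2 B.
  move=> mB.
  apply: (@g_sigma_algebra_measure_unique _ R (T * \bar R)%type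
    [set B1 `*` B2 | B1 in measurable & B2 in measurable] _ (fun=> setT) _ _ M1 M2) => //.
  - by move=> _ [B1 mB1 [B2 mB2 <-]]; exact: measurableX.
  - by move=> k; exists setT => //; exists setT => //; rewrite setXTT.
  - by rewrite bigcup_const//; exists 0%N.
  - move=> _ _ [B1 mB1 [B2 mB2 <-]] [C1 mC1 [C2 mC2 <-]].
    exists (B1 `&` C1); first exact: measurableI.
    by exists (B2 `&` C2); [exact: measurableI|rewrite setXI].
  - move=> _ [B1 mB1 [B2 mB2 <-]].
    rewrite /M1 /M2 /image_measure/= /pushforward/= /mrestr/=.
    rewrite (_ : _ `&` A = A `&` Z @^-1` B1 `&` L @^-1` B2); last first.
      by apply/seteqP; split=> w /=; tauto.
    rewrite HL// /product_measure1 integral_mkcond; apply: eq_integral => w _.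
    rewrite patchE; case: ifPn => [/set_mem[Aw B1w]|/negP nw] /=.
      rewrite lifetime_law_exp1//; congr (exp1 R _).
      apply/seteqP; split=> y /=; rewrite /xsection/=.
        by move=> ?; apply/mem_set.
      by move=> /set_mem[[]].
    rewrite -[LHS](measure0 (exp1 R)); congr (exp1 R _).
    apply/seteqP; split=> // y; rewrite /xsection/= => /set_mem[[/= B1w _] [Aw _]].
    by apply: nw; apply/mem_set.
  - move=> k; apply: (@le_lt_trans _ _ 1); last exact: ltry.
    apply: probability_le1; apply: measurableI => //.
    by rewrite -[X in measurable X]setTI; exact: (mZL measurableT).
  - by have := mB; rewrite measurable_prod_measurableType.
rewrite [LHS]integral_mkcond [RHS]integral_mkcond.
under eq_integral do rewrite epatch_indic/=.
have mg' : measurable_fun setT (g \o psi) by exact: measurableT_comp.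
rewrite (@transfer_integral _ (T * \bar R)%type R _ _ _ (Omega * measurableTypeR R)%type
  P (P \x exp1 R) (fun w => (Z w, L w)) psi \1_A \1_A2 g)//.
- rewrite fubini_tonelli1//; last 2 first.
  + apply: emeasurable_funM => //.
    by apply/measurable_EFinP; exact: measurable_indic.
  + by move=> p; rewrite mule_ge0// lee_fin.
  apply: eq_integral => w _; rewrite /fubini_F patchE; case: ifPn => Aw.
    apply: eq_integral => y _; rewrite /psi/= indicE.
    by rewrite mem_set ?mule1//; split => //; exact: set_mem.
  under eq_integral => y _.
    rewrite indicE memNset; last by move=> [/= /mem_set h _]; move/negP : Aw; exact.
    rewrite mule0; over.
  by rewrite integral0.
- move=> B mB; have := M12 _ mB; rewrite /M1 /M2 /image_measure/= /pushforward/= /mrestr/=.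
  rewrite !integral_indic//.
  + by rewrite setIC [in X in _ = X -> _]setIC.
  + by rewrite -[X in measurable X]setTI; exact: (mpsi measurableT).
  + by rewrite -[X in measurable X]setTI; exact: (mZL measurableT).
Qed.

End clock.

Section clock_integrals.
Local Open Scope ereal_scope.
Variable R : realType.
Implicit Types (lam kappa t u : R) (x s : \bar R).

(** The probability that a set separated at rate kappa and not separated at time s
    is still not separated at time t. *)
Definition survival kappa t s : R :=
  expR (- kappa * (t - fine s)) * \1_[set` Interval (BRight -oo) (BRight t%:E)] s.

(** The factor exp (- s), which is 0 at infinity.  Its mean over the births of the
    cells of one generation contracts from each generation to the next, which the
    probability of a birth before time t need not do. *)
Definition discount s : R := expR (- fine s) * \1_[set` Interval (BRight -oo) (BLeft +oo)] s.

Lemma survival_ge0 kappa t s : (0 <= survival kappa t s)%R.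
Proof. by rewrite mulr_ge0// expR_ge0. Qed.

Lemma discount_ge0 s : (0 <= discount s)%R.
Proof. by rewrite mulr_ge0// expR_ge0. Qed.

Lemma survivalE kappa t (r : R) : survival kappa t r%:E =
  (if r <= t then expR (- kappa * (t - r)) else 0)%R.
Proof.
rewrite /survival indicE/=; case: ifPn => rt.
  by rewrite mem_set ?mulr1//= in_itv/= ltNyr lee_fin.
by rewrite memNset ?mulr0//= in_itv/= ltNyr lee_fin (negbTE rt).
Qed.

Lemma discountE (r : R) : discount r%:E = expR (- r).
Proof. by rewrite /discount indicE/= mem_set ?mulr1//= in_itv/= ltNyr ltry. Qed.

Lemma survivalNy kappa t : survival kappa t -oo = 0%R.
Proof. by rewrite /survival indicE memNset ?mulr0//= in_itv. Qed.

Lemma survivaly kappa t : survival kappa t +oo = 0%R.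
Proof. by rewrite /survival indicE memNset ?mulr0//= in_itv. Qed.

Lemma discountNy : discount -oo = 0%R.
Proof. by rewrite /discount indicE memNset ?mulr0//= in_itv. Qed.

Lemma discounty : discount +oo = 0%R.
Proof. by rewrite /discount indicE memNset ?mulr0//= in_itv. Qed.

Lemma measurable_survival kappa t : measurable_fun setT (survival kappa t).
Proof.
apply: measurable_funM; last exact/measurable_indic/emeasurable_itv.
apply: measurableT_comp => //; apply: measurable_funM => //.
by apply: measurable_funB => //; exact: fine_measurable.
Qed.

Lemma measurable_discount : measurable_fun setT discount.
Proof.
apply: measurable_funM; last exact/measurable_indic/emeasurable_itv.
apply: measurableT_comp => //; apply: measurableT_comp => //; exact: fine_measurable.
Qed.

Lemma integral_exp1 (f : R -> R) : measurable_fun setT f -> (forall y, 0 <= f y)%R ->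
  \int[exp1 R]_y (f y)%:E =
  \int[lebesgue_measure]_y (f y * exponential_pdf 1 y)%:E.
Proof.
move=> mf f0.
have := @transfer_integral _ (measurableTypeR R) R _ _ (measurableTypeR R)
  (measurableTypeR R) (exp1 R) lebesgue_measure id id (cst 1%R) (exponential_pdf 1) (EFin \o f).
move=> /(_ _ _ _ _ _ _ _ _ _)-h.
transitivity (\int[exp1 R]_x ((EFin \o f) (id x) * (cst 1%R x)%:E)).
  by apply: eq_integral => y _; rewrite /= mule1.
rewrite h//.
- exact: measurable_exponential_pdf.
- by move=> y; rewrite exponential_pdf_ge0.
- move=> B mB; rewrite preimage_id.
  by rewrite -[LHS]/(\int[exp1 R]_(x in B) cst 1 x) integral_cst// mul1e.
- exact/measurable_EFinP.
Qed.

Lemma exp1_ray_oy u : (0 <= u)%R -> exp1 R `]u, +oo[%classic = (expR (- u))%:E.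
Proof.
move=> u0; have := @exponential_prob_ray R 1 u ltr01; rewrite u0 mulN1r => <-.
rewrite /= /exponential_prob integral_itv_obnd_cbnd//.
by apply/measurable_funTS/measurableT_comp => //; exact: measurable_exponential_pdf.
Qed.

Definition alive t : set (\bar R * \bar R) :=
  [set p | (p.1 <= t%:E < p.1 + p.2)%E].

Lemma measurable_alive t : measurable (alive t).
Proof.
rewrite (_ : alive t = [set p | (p.1 <= t%:E)%E] `&` [set p | (t%:E < p.1 + p.2)%E]).
  apply: measurableI.
    rewrite -[X in measurable X]setTI; exact: emeasurable_fun_le.
  rewrite -[X in measurable X]setTI; apply: emeasurable_fun_lt => //.
  exact: emeasurable_funD.
by apply/seteqP; split=> p; [move/andP|move=> h; exact/andP].
Qed.

Lemma exponential_prob_itv0 (q z : R) : (0 < q)%R -> (0 <= z)%R ->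
  exponential_prob q `[0%R, z]%classic = (1 - expR (- q * z))%:E.
Proof.
move=> q0; rewrite le_eqVlt => /predU1P[<-|z0].
  by rewrite /exponential_prob set_itv1 integral_set1 mulr0 expR0 subrr.
by rewrite exponential_prob_itv0c.
Qed.

Lemma scaled_life_neqNy lam y : scaled_life lam y != -oo.
Proof. by rewrite /scaled_life; case: ifP. Qed.

(** Let a cell born at time x split at rate lam.  Either it is alive at time t, or it
    splits before t, and its hyperplane then spares the set with probability
    (lam - kappa) / lam, after which the same question arises at the time of the
    split. *)
Lemma clock_survival kappa lam t x : (0 <= kappa <= lam)%R ->
  (survival kappa t x)%:E =
  \int[exp1 R]_y (\1_(alive t) (x, scaled_life lam y))%:E +
  \int[exp1 R]_y (survival kappa t (x + scaled_life lam y) * ((lam - kappa) / lam))%:E.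
Proof.
move=> /andP[k0 kl].
have Z0 (f : R -> R) : (forall y, f y = 0)%R -> \int[exp1 R]_y (f y)%:E = 0.
  by move=> f0; apply: integral0_eq => y _; rewrite f0.
case: x => [r| |]; last 2 first.
- rewrite survivaly [X in X + _]Z0 ?[X in _ + X]Z0 ?adde0// => y.
    by rewrite addye ?scaled_life_neqNy// survivaly mul0r.
  by rewrite indicE memNset//=; rewrite leye_eq.
- rewrite survivalNy [X in X + _]Z0 ?[X in _ + X]Z0 ?adde0// => y.
    by rewrite mul0r.
  by rewrite indicE memNset// => /andP[_]; rewrite /= ltNge leNye.
(* a cell of rate 0 never splits *)
have [l0|l0] := eqVneq lam 0%R.
  have k00 : kappa = 0%R by apply/eqP; rewrite eq_le k0 -l0 kl.
  rewrite survivalE k00 oppr0 mul0r expR0.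
  rewrite [X in _ + X]Z0 => [|y]; last by rewrite l0 invr0 !mulr0.
  rewrite adde0; transitivity (\int[exp1 R]_y cst ((r <= t)%R%:R%:E) y).
    rewrite integral_cst// [X in _ * X](@probability_setT _ _ _ (exp1 R)) mule1.
    by case: ifP.
  apply: eq_integral => y _; rewrite /scaled_life l0 ltxx indicE; congr ((nat_of_bool _)%:R%:E).
  apply/idP/idP => [rt|/set_mem/andP[]]; last by rewrite lee_fin.
  by apply/mem_set/andP; rewrite lee_fin rt addey// ltry.
have {}l0 : (0 < lam)%R by rewrite lt_neqAle eq_sym l0 (le_trans k0).
have slE y : scaled_life lam y = (y / lam)%:E by rewrite /scaled_life l0.
have mf : measurable_fun setT (fun y : R => survival kappa t (r%:E + scaled_life lam y) * ((lam - kappa) / lam))%R.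
  apply: measurable_funM => //.
  apply: (measurableT_comp (measurable_survival kappa t)).
  under eq_fun do rewrite slE; apply: emeasurable_funD => //.
  by apply/measurable_EFinP; exact: mulrr_measurable.
have [rt|tr] := leP r t; last first.
  rewrite survivalE leNgt tr [X in X + _]Z0 => [|y]; last first.
    by rewrite indicE memNset// => /andP[]; rewrite lee_fin leNgt tr.
  rewrite add0e integral_exp1//; last first.
    by move=> y; rewrite mulr_ge0 ?survival_ge0// divr_ge0 ?subr_ge0// ltW.
  apply/esym/integral0_eq => y _.
  have [y0|y0] := ltP y 0%R; first by rewrite lt0_exponential_pdf// mulr0.
  rewrite slE survivalE ifF ?mul0r//; apply/negP/negP; rewrite -ltNge.
  by rewrite (lt_le_trans tr)// lerDl divr_ge0// ltW.
set u := (t - r)%R; have u0 : (0 <= u)%R by rewrite subr_ge0.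
have -> : \int[exp1 R]_y (\1_(alive t) (r%:E, scaled_life lam y))%:E
    = (expR (- (lam * u)))%:E.
  rewrite -exp1_ray_oy ?mulr_ge0 ?(ltW l0)//.
  transitivity (\int[exp1 R]_y (\1_(`](lam * u)%R, +oo[%classic) y)%:E); last first.
    by rewrite integral_indic// setIT.
  apply: eq_integral => y _; congr (_%:E); rewrite !indicE; congr ((nat_of_bool _)%:R).
  have E1 : (t < r + y / lam)%R = (lam * u < y)%R.
    by rewrite -ltrBlDl ltr_pdivlMr// mulrC.
  apply/idP/idP => /set_mem.
    by move=> /andP[_]; rewrite slE lte_fin E1 => h; apply/mem_set; rewrite /= in_itv/= h.
  rewrite /= in_itv/= andbT => h; apply/mem_set/andP.
  by rewrite slE lee_fin rt lte_fin E1.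
rewrite survivalE rt -/u.
have [kle|kl'] := eqVneq kappa lam.
  rewrite [X in _ + X]Z0 => [|y]; last by rewrite kle subrr mul0r mulr0.
  by rewrite adde0 kle mulNr.
set q := ((lam - kappa) / lam)%R in mf *.
have q0 : (0 < q)%R by rewrite divr_gt0// subr_gt0 lt_neqAle kl'.
rewrite integral_exp1//; last first.
  by move=> y; rewrite mulr_ge0 ?survival_ge0// ltW.
have -> : \int[lebesgue_measure]_y
   (survival kappa t (r%:E + scaled_life lam y) * q * exponential_pdf 1 y)%:E =
   (expR (- kappa * u))%:E * exponential_prob q `[0%R, (lam * u)%R]%classic.
  rewrite /exponential_prob -ge0_integralZl//; last 2 first.
  - by apply/measurable_EFinP/measurable_funTS; exact: measurable_exponential_pdf.
  - by move=> y _; rewrite lee_fin exponential_pdf_ge0// ltW.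
  rewrite [RHS]integral_mkcond; apply: eq_integral => y _.
  rewrite slE survivalE patchE.
  have E1 : (r + y / lam <= t)%R = (y <= lam * u)%R.
    by rewrite -lerBrDl ler_pdivrMr// mulrC.
  rewrite E1; have [y0|y0] := ltP y 0%R.
    rewrite lt0_exponential_pdf// mulr0 memNset//= in_itv/= leNgt y0.
    by [].
  have [yu|yu] := leP y (lam * u)%R; last first.
    by rewrite !mul0r memNset//= in_itv/= y0/= leNgt yu.
  rewrite mem_set/= ?in_itv/= ?y0//; rewrite !exponential_pdfE//.
  rewrite -EFinM mul1r -[in LHS]mulrA [in LHS]mulrCA -expRD [in RHS]mulrCA -expRD.
  congr ((_ * expR _)%:E).
  by rewrite /q /u; field; rewrite gt_eqF.
have -> : (expR (- (lam * u)) = expR (- kappa * u) * expR (- q * (lam * u)))%R.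
  by rewrite -expRD; congr expR; rewrite /q; field; rewrite gt_eqF.
rewrite exponential_prob_itv0 ?mulr_ge0 ?(ltW l0)// -EFinM -EFinD; congr (_%:E).
by ring.
Qed.

(** The mean of exp (- L) for an exponential variable L of parameter lam is
    lam / (lam + 1), which increases with lam. *)
Lemma clock_discount lam (a : R) x : (0 <= lam <= a)%R ->
  \int[exp1 R]_y (discount (x + scaled_life lam y))%:E <=
  (discount x * (a / (a + 1)))%:E.
Proof.
move=> /andP[l0 la]; have a0 : (0 <= a)%R by exact: le_trans la.
have Z0 (f : R -> R) : (forall y, f y = 0)%R -> \int[exp1 R]_y (f y)%:E = 0.
  by move=> f0; apply: integral0_eq => y _; rewrite f0.
have rhs0 z : 0 <= (discount z * (a / (a + 1)))%:E.
  by rewrite lee_fin mulr_ge0 ?discount_ge0// divr_ge0// addr_ge0.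
case: x => [r| |]; last 2 first.
- rewrite Z0// => y.
  by rewrite addye ?scaled_life_neqNy// discounty.
- rewrite Z0// => y.
  by rewrite addNye discountNy.
move: l0; rewrite le_eqVlt => /predU1P[l0|l0].
  by rewrite Z0// => y; rewrite /scaled_life -l0 ltxx addey// discounty.
have slE y : scaled_life lam y = (y / lam)%:E by rewrite /scaled_life l0.
pose p := (1 + lam^-1)%R; have p0 : (0 < p)%R by rewrite addr_gt0// invr_gt0.
under eq_integral do rewrite slE discountE.
rewrite integral_exp1; last 2 first.
- apply: measurableT_comp => //; apply: measurableT_comp => //.
  by apply: measurable_funD => //; exact: mulrr_measurable.
- by move=> y; exact: expR_ge0.
under eq_integral => y _.
  rewrite (_ : (_ * _)%R = (expR (- r) / p * exponential_pdf p y)%R); last first.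
    have [y0|y0] := ltP y 0%R; first by rewrite !lt0_exponential_pdf// !mulr0.
    rewrite !exponential_pdfE// mul1r -expRD mulrA divfK ?gt_eqF// -expRD; congr expR.
    by rewrite /p; field; rewrite gt_eqF.
  rewrite EFinM; over.
rewrite ge0_integralZl//; last 3 first.
- by apply/measurable_EFinP; exact: measurable_exponential_pdf.
- by move=> y _; rewrite lee_fin exponential_pdf_ge0// ltW.
- by rewrite lee_fin divr_ge0 ?expR_ge0// ltW.
rewrite integral_exponential_pdf// mule1 discountE lee_fin ler_wpM2l ?expR_ge0//.
have -> : (p^-1 = lam / (lam + 1))%R.
  by rewrite /p; field; rewrite !gt_eqF ?addr_gt0.
rewrite ler_pdivrMr ?addr_gt0// mulrAC ler_pdivlMr ?ltr_wpDl//.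
by rewrite !mulrDr !mulr1 mulrC lerD2l.
Qed.

End clock_integrals.

(** * The cells of the splitting construction *)

Section cells.
Variables (R : realType) (n : nat).
Local Notation E := 'rV[R]_n.+1.
Local Notation HH := (hyperplane R n).
Local Notation Q := (@rational_point R n).
Variable W : set E.
Hypotheses (W_compact : compact W) (W_convex : convex_set W)
  (W_interior : interior W !=set0).

Definition body (cut : seq bool -> HH) (v : seq bool) : cell_space R n :=
  odflt set0 (cell W cut v).

Lemma closed_W : closed W.
Proof. by apply: compact_closed => //; exact: norm_hausdorff. Qed.

Lemma cell_convex_body cut v c : cell W cut v = Some c -> convex_body c /\ c `<=` W.
Proof.
elim: v c => [c [<-]|b u ih c] /=.
  by split => //; split => //; exact: closed_W.
case: (cell W cut u) ih => // c' /(_ _ erefl)[bc' c'W].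
case: asboolP => [hc' [<-]|_].
  by split; [exact: convex_body_split|move=> x [/c'W]].
by case: b => // -[<-].
Qed.

Lemma convex_body_regular c : @convex_body R n c -> c `<=` closure (interior c).
Proof. by move=> [_ cc ic]; exact: convex_closure_interior. Qed.

Lemma cell_compact cut v c : cell W cut v = Some c -> compact c.
Proof.
move=> /cell_convex_body[[cc _ _] cW].
exact: subclosed_compact cc W_compact cW.
Qed.

Lemma body_interior_is_some cut v x : interior (body cut v) x ->
  cell W cut v = Some (body cut v : set E).
Proof.
by rewrite /body; case: cell => // /= h; have : (set0 : set E) x by exact: interior_subset h.
Qed.

Lemma interior_body_cons cut b u x :
  interior (body cut (b :: u)) x <->
  interior (body cut u) x /\
  if `[< hset (cut u) `&` interior (body cut u) !=set0 >]
  then interior (halfspace b (cut u)) x else b.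
Proof.
rewrite /body /=; case: (cell W cut u) => [c|]/=; last first.
  by rewrite interior0; split => //; case.
case: asboolP => h /=; first by rewrite interiorI.
by case: b => /=; [split => // -[]|rewrite interior0; split => // -[]].
Qed.

Definition covers (S : seq E) (c : set E) : Prop := forall x, x \in S -> interior c x.

Lemma covers_consP cut b u (S : seq E) : S != [::] ->
  covers S (body cut (b :: u)) <-> covers S (body cut u) /\
   if `[< hset (cut u) `&` interior (body cut u) !=set0 >]
   then (forall x, x \in S -> interior (halfspace b (cut u)) x) else b.
Proof.
move=> S0; split.
  move=> h; split; first by move=> x /h /interior_body_cons[].
  case: asboolP => hu.
    by move=> x /h /interior_body_cons[_]; case: asboolP.
  case: (S) S0 h => // x S' _ /(_ x); rewrite mem_head => /(_ isT).
  by move=> /interior_body_cons[_]; case: asboolP.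
move=> [h h'] x xS; apply/interior_body_cons; split; first exact: h.
by case: asboolP h' => // _; exact.
Qed.

(** The interior of a cell being convex, a hyperplane meeting the convex hull of
    points in the interior does split the cell. *)
Lemma covers_hits_hull cut u (S : seq E) : covers S (body cut u) ->
  hits_hull S (cut u) -> hset (cut u) `&` interior (body cut u) !=set0.
Proof.
move=> Su [x [y [xS yS [z [Hz xyz]]]]]; exists z; split => //.
have [[_ xc _] _] := cell_convex_body (body_interior_is_some (Su _ xS)).
have /convex_setP := convex_interior xc; apply; last exact: xyz.
- exact: Su.
- exact: Su.
Qed.

(** If the hyperplane spares the convex hull of S, then S lies on one side of it, or
    the cell is not split at all; in this case its continuation is labelled
    true :: u. *)
Lemma covers_child cut u (S : seq E) : S != [::] ->
  (exists b, covers S (body cut (b :: u))) <->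
  covers S (body cut u) /\ ~ hits_hull S (cut u).
Proof.
move=> S0; split.
  move=> [b /covers_consP-/(_ S0)[Su hb]]; split => // hS.
  have hu := covers_hits_hull Su hS.
  move: hb; case: asboolP => // _ hb.
  have [+ _] := hits_hullPn (cut u) S0; apply => //; first by exists b.
move=> [Su nh].
have [hu|hu] := pselect (hset (cut u) `&` interior (body cut u) !=set0).
  have /(hits_hullPn (cut u) S0)[b bS] := nh.
  by exists b; apply/covers_consP => //; split => //; case: asboolP.
by exists true; apply/covers_consP => //; split => //; case: asboolP.
Qed.

Lemma covers_child_unique cut u (S : seq E) : S != [::] ->
  covers S (body cut (true :: u)) -> ~ covers S (body cut (false :: u)).
Proof.
move=> S0 /(covers_consP _ _ _ S0)[Su h] /(covers_consP _ _ _ S0)[_ h'].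
case: asboolP h h' => // _.
case: (S) S0 => // x S' _ /(_ x) + /(_ x); rewrite mem_head.
by move=> /(_ isT) h1 /(_ isT) h2; have := side_unique h1 h2.
Qed.

Lemma covers_hull_sub S c (H : HH) : convex_set c -> covers S c ->
  hits_hull S H -> hits c H.
Proof.
move=> xc Sc [x [y [xS yS [z [Hz xyz]]]]]; exists z; split => //.
move/convex_setP: xc => /(_ x y); apply; last exact: xyz.
- by apply: interior_subset; exact: Sc.
- by apply: interior_subset; exact: Sc.
Qed.

Lemma measurable_covers (ks : seq nat) :
  measurable ([set c : cell_space R n | covers (map Q ks) c]).
Proof.
rewrite (_ : [set _ | _] = cylinder ks); first exact: measurable_cylinder.
apply/seteqP; split=> c h; first by move=> k kk; apply: h; exact: map_f.
by move=> _ /mapP[k kk ->]; exact: h.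
Qed.

(** The cell with label v is a function of the hyperplanes of its ancestors.  Such a
    hyperplane cuts the interior of the parent cell if and only if it meets a segment
    between two of its interior rational points. *)
Lemma measurable_body d (T : measurableType d) (cut : seq bool -> T -> HH) v :
  (forall u, (size u < size v)%N -> suffix u v -> measurable_fun setT (cut u)) ->
  measurable_fun setT (fun w => body (cut^~ w) v).
Proof.
elim: v => [_|b u ih mcut].
  apply: measurable_fun_cell_space => k; rewrite /body/=.
  have [Wk|nWk] := pselect (interior W (Q k)).
    by rewrite (_ : [set _ | _] = setT)//; apply/seteqP; split.
  by rewrite (_ : [set _ | _] = set0)//; apply/seteqP; split.
have {}ih : measurable_fun setT (fun w => body (cut^~ w) u).
  apply: ih => z zu szu; apply: mcut; first by rewrite /= ltnW.
  by rewrite -cat1s; exact: suffix_catr.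
have mu : measurable_fun setT (cut u).
  by apply: mcut => //=; exact: suffix_cons.
have mint k : measurable [set w | interior (body (cut^~ w) u) (Q k)].
  rewrite -[X in measurable X]setTI.
  by apply: (ih measurableT [set c | interior c (Q k)]); exact: measurable_interior_at.
pose hu := [set w | hset (cut u w) `&` interior (body (cut^~ w) u) !=set0].
have mhu : measurable hu.
  rewrite (_ : hu = \bigcup_(p in [set: nat * nat])
      ([set w | interior (body (cut^~ w) u) (Q p.1)] `&`
       [set w | interior (body (cut^~ w) u) (Q p.2)] `&`
       cut u @^-1` hits (segment (Q p.1) (Q p.2)))).
    apply: countable_bigcupT_measurable; first exact: countableP.
    move=> p; apply: measurableI; first exact: measurableI.
    rewrite -[X in measurable X]setTI; apply: mu => //.
    exact: measurable_hits_segment.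
  apply/seteqP; split=> w.
    move=> [x [Hx ix]].
    have sideQ b' : exists k, interior (body (cut^~ w) u) (Q k) /\
                              interior (halfspace b' (cut u w)) (Q k).
      have [y iy hy] := near_hyperplane b' Hx (open_nbhs_nbhs (conj (@open_interior _ _) ix)).
      have [k [ik hk]] : exists k, (interior (body (cut^~ w) u) `&`
          interior (halfspace b' (cut u w))) (Q k).
        apply: rational_point_dense; last by exists y.
        by apply: openI; exact: open_interior.
      by exists k.
    have [k [ik hk]] := sideQ true; have [k' [ik' hk']] := sideQ false.
    exists (k, k') => //; split => //=; apply: contrapT => nh.
    by have := side_unique (side_nhits_trans hk nh) hk'.
  move=> [[k k'] _ [[/= ik ik'] [z [Hz kk'z]]]]; exists z; split => //.
  have [[_ xc _] _] := cell_convex_body (body_interior_is_some ik).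
  have /convex_setP := convex_interior xc; apply; last exact: kk'z.
  - exact: ik.
  - exact: ik'.
apply: measurable_fun_cell_space => k.
rewrite (_ : [set _ | _] = [set w | interior (body (cut^~ w) u) (Q k)] `&`
  ((hu `&` cut u @^-1` [set H | interior (halfspace b H) (Q k)]) `|`
   (~` hu `&` [set _ | b]))).
  apply: measurableI => //; apply: measurableU; apply: measurableI => //.
  - rewrite -[X in measurable X]setTI; apply: mu => //; exact: measurable_side.
  - exact: measurableC.
  - case: (b); [rewrite (_ : [set _ | _] = setT)//|rewrite (_ : [set _ | _] = set0)//];
    by apply/seteqP; split.
apply/seteqP; split=> w.
  move=> /interior_body_cons[ik]; case: asboolP => h h'; split => //; first by left.
  by right.
by move=> [ik [[h h']|[h h']]]; apply/interior_body_cons; split => //; case: asboolP.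
Qed.

End cells.

(** * Cells of the splitting construction around a finite set *)

Fixpoint words N : seq (seq bool) :=
  if N is N'.+1 then map (cons true) (words N') ++ map (cons false) (words N')
  else [:: [::]].

Fixpoint short_words N : seq (seq bool) :=
  if N is N'.+1 then short_words N' ++ words N' else [::].

Lemma mem_words N v : (v \in words N) = (size v == N).
Proof.
elim: N v => [|N ih] [|b v] //=.
- by apply/negbTE; rewrite mem_cat negb_or; apply/andP; split; apply/negP => /mapP[].
- rewrite mem_cat eqSS -ih; case: b.
    rewrite mem_map; last by move=> ? ? [].
    by rewrite [X in _ || X](_ : _ = false) ?orbF//; apply/negbTE/negP => /mapP[].
  rewrite orbC mem_map; last by move=> ? ? [].
  by rewrite [X in _ || X](_ : _ = false) ?orbF//; apply/negbTE/negP => /mapP[].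
Qed.

Lemma mem_short_words N v : (v \in short_words N) = (size v < N)%N.
Proof. by elim: N => //= N ih; rewrite mem_cat ih mem_words ltnS [RHS]leq_eqVlt orbC. Qed.

Lemma words_uniq N : uniq (words N).
Proof.
elim: N => //= N ih; rewrite cat_uniq !map_inj_uniq ?ih ?andbT/=; try by move=> ? ? [].
by apply/hasPn => _ /mapP[v _ ->]; apply/negP => /mapP[].
Qed.

Lemma short_words_uniq N : uniq (short_words N).
Proof.
elim: N => //= N ih; rewrite cat_uniq ih words_uniq andbT/=.
by apply/hasPn => v; rewrite mem_words mem_short_words => /eqP ->; rewrite ltnn.
Qed.

Lemma sum_words (R : realType) (f : seq bool -> \bar R) N :
  (\sum_(v <- words N.+1) f v =
   \sum_(v <- words N) (f (true :: v) + f (false :: v)))%E.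
Proof. by rewrite big_cat !big_map/= -big_split. Qed.


Section splitting_process.
Local Open Scope ereal_scope.
Variables (R : realType) (n : nat).
Local Notation E := 'rV[R]_n.+1.
Local Notation HH := (hyperplane R n).
Local Notation Q := (@rational_point R n).
Variables (Lambda : {measure set HH -> \bar R}) (W : set E).
Hypotheses (Lambda_lf : locally_finite Lambda)
  (W_compact : compact W) (W_convex : convex_set W)
  (W_interior : interior W !=set0).
Context d (Omega : measurableType d) (P : probability Omega R).
Variables (life : seq bool -> Omega -> \bar R) (cut : seq bool -> Omega -> HH).
Hypothesis HY : cell_splitting W P Lambda life cut.

Let mhW : measurable (hits W : set HH). Proof. exact: measurable_hits_compact. Qed.
Let LW : Lambda (hits W) < +oo. Proof. exact: Lambda_lf. Qed.
Let LambdaW := mfrestr mhW LW.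

Let B v w := body W (cut^~ w) v.
Let birth_at v w := birth (life^~ w) v.

(** Lambda [c], for the cells c; restricting Lambda to the hyperplanes meeting W
    makes it finite and measurable for all c. *)
Definition cell_rate (c : cell_space R n) : R := fine (LambdaW (xsection (@hits_cell R n) c)).

Let mxhits c : measurable (xsection (@hits_cell R n) c).
Proof. by apply: measurable_xsection; exact: measurable_hits_cell. Qed.

Lemma measurable_cell_rate : measurable_fun setT cell_rate.
Proof.
apply: measurableT_comp; first exact: fine_measurable.
exact: (measurable_fun_xsection LambdaW (@measurable_hits_cell R n)).
Qed.

Lemma cell_rate_ge0 c : (0 <= cell_rate c)%R.
Proof. by rewrite fine_ge0// measure_ge0. Qed.

Lemma cell_rate_le c : (cell_rate c <= fine (Lambda (hits W)))%R.
Proof.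
rewrite fine_le// ?fin_num_measure// ?ge0_fin_numE//.
rewrite /LambdaW /mfrestr /mrestr; apply: le_measure.
- by apply: mem_set; exact: measurableI.
- exact: mem_set.
- exact: subIsetr.
Qed.

Lemma cell_rateE v w : cell_at W cut v w ->
  cell_at W cut v w = Some (B v w : set E) /\
  cell_rate (B v w) = fine (Lambda (hits (B v w : set E))).
Proof.
rewrite /B /body /cell_at.
case cE : (cell W (cut^~ w) v) => [c|]//= _; split => //.
have [bc cW] := cell_convex_body W_compact W_convex W_interior cE.
rewrite /cell_rate hits_cellE; last 2 first.
- exact: cell_compact cE.
- exact: convex_body_regular bc.
congr (fine _); rewrite /LambdaW /mfrestr /mrestr; congr (Lambda _).
by apply/setIidl => H [x [Hx /cW Wx]]; exists x.
Qed.

Lemma covers_cell_at S v w : S != [::] -> covers S (B v w) -> cell_at W cut v w.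
Proof.
case: S => // x S _ /(_ x); rewrite mem_head => /(_ isT) h.
by rewrite /cell_at (body_interior_is_some h).
Qed.

Lemma measurable_birth d' (T : measurableType d') (life' : seq bool -> T -> \bar R) v :
  (forall u, (size u < size v)%N -> suffix u v -> measurable_fun setT (life' u)) ->
  measurable_fun setT (fun w => birth (life'^~ w) v).
Proof.
elim: v => [_|b u ih ml] /=; first exact: measurable_cst.
apply: emeasurable_funD; last by apply: ml => //; exact: suffix_cons.
apply: ih => z zu szu; apply: ml; first by rewrite /= ltnW.
by rewrite -cat1s; exact: suffix_catr.
Qed.

Let Past v := g_sigma_algebraType (elsewhere_gen life cut v).
Let PastLife v := g_sigma_algebraType (elsewhere_gen life cut v `|`
  preimage_set_system setT (life v) measurable).

Lemma not_suffix_short (u v : seq bool) : (size u < size v)%N -> ~~ suffix v u.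
Proof. by apply: contraTN => /size_suffix; rewrite leqNgt. Qed.

Let measurable_life_elsewhere v u : (size u < size v)%N ->
  measurable_fun setT (life u : Past v -> \bar R).
Proof.
move=> uv _ A mA; apply: sub_sigma_algebra; exists u; first exact: not_suffix_short.
by left; exists A.
Qed.

Let measurable_cut_elsewhere v u : (size u < size v)%N ->
  measurable_fun setT (cut u : Past v -> HH).
Proof.
move=> uv _ A mA; apply: sub_sigma_algebra; exists u; first exact: not_suffix_short.
by right; exists A.
Qed.

Lemma elsewhere_measurable v : elsewhere life cut v `<=` measurable.
Proof.
apply: smallest_sub; first exact: sigma_algebra_measurable.
by move=> A [u _ [] [C mC <-]]; [apply: (measurable_life HY)|apply: (measurable_cut HY)].
Qed.

Lemma measurable_body_elsewhere v : measurable_fun setT (B v : Past v -> cell_space R n).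
Proof. by apply: measurable_body => // u uv _; exact: measurable_cut_elsewhere. Qed.

Lemma measurable_birth_elsewhere v : measurable_fun setT (birth_at v : Past v -> \bar R).
Proof. by apply: measurable_birth => // u uv _; exact: measurable_life_elsewhere. Qed.

Lemma sub_elsewhere_or_life v : elsewhere life cut v `<=` elsewhere_or_life life cut v.
Proof.
apply: smallest_sub; first exact: smallest_sigma_algebra.
by move=> A hA; apply: sub_sigma_algebra; left.
Qed.

Let covering (ks : seq nat) v := [set w | covers (map Q ks) (B v w)].

Lemma elsewhere_covers ks v : elsewhere life cut v (covering ks v).
Proof.
have := @measurable_body_elsewhere v measurableT _ (@measurable_covers R n ks).
by rewrite setTI.
Qed.

Let mcovering ks v : measurable (covering ks v).
Proof. by apply: (@elsewhere_measurable v); exact: elsewhere_covers. Qed.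

Let mB v : measurable_fun setT (B v : Omega -> cell_space R n).
Proof. by apply: measurable_body => // u _ _; exact: (measurable_cut HY). Qed.

Let mbirth v : measurable_fun setT (birth_at v).
Proof. by apply: measurable_birth => // u _ _; exact: (measurable_life HY). Qed.

Let birth_rate v w := (birth_at v w, cell_rate (B v w)).

Let mbirth_rate_elsewhere v : measurable_fun setT (birth_rate v : Past v -> \bar R * R).
Proof.
apply: measurable_fun_pair; first exact: measurable_birth_elsewhere.
apply: measurableT_comp; first exact: measurable_cell_rate.
exact: measurable_body_elsewhere.
Qed.

Let mbirth_rate v : measurable_fun setT (birth_rate v).
Proof.
apply: measurable_fun_pair => //.
by apply: measurableT_comp; first exact: measurable_cell_rate.
Qed.

(** The cell v and its birth are determined by the ancestors of v, so the law of the
    lifetime of v given the cell applies on the event that the points of ks are in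
    its interior. *)
Lemma splitting_clock ks v (g : \bar R -> R -> \bar R -> \bar R) : ks != [::] ->
  measurable_fun setT (fun p : \bar R * R * \bar R => g p.1.1 p.1.2 p.2) ->
  (forall x lam y, 0 <= g x lam y) ->
  \int[P]_(w in covering ks v) g (birth_at v w) (cell_rate (B v w)) (life v w) =
  \int[P]_(w in covering ks v) \int[exp1 R]_y
    g (birth_at v w) (cell_rate (B v w)) (scaled_life (cell_rate (B v w)) y).
Proof.
move=> ks0 mg g0.
have ks0' : map Q ks != [::] by case: (ks) ks0.
have := @exponential_clock R _ Omega P _ (\bar R * R)%type (birth_rate v)
  (fun z => `|z.2|%R) (life v) (covering ks v) (fun p => g p.1.1 p.1.2 p.2).
move=> /(_ _ _ _ _ _ _ _ _)-h; rewrite h//.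
- apply: eq_integral => w _; apply: eq_integral => y _ /=.
  by rewrite ger0_norm// cell_rate_ge0.
- exact: measurableT_comp.
- exact: (measurable_life HY).
- move=> B1 B2 mB1 mB2.
  have eA : elsewhere life cut v (covering ks v `&` birth_rate v @^-1` B1).
    apply: (@measurableI _ (Past v)); first exact: elsewhere_covers.
    by rewrite -[X in measurable X]setTI; exact: mbirth_rate_elsewhere.
  have := life_law HY eA mB2.
  rewrite (_ : _ `&` [set w | cell_at W cut v w] = covering ks v `&` birth_rate v @^-1` B1); last first.
    by apply/setIidl => w [/(covers_cell_at ks0')].
  move=> ->; apply: eq_integral => w /set_mem[Aw _].
  have [-> rE] := cell_rateE (covers_cell_at ks0' Aw).
  by rewrite /birth_rate /= rE ger0_norm// fine_ge0.
Qed.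

Section potentials.
Variables (t : R) (ks : seq nat).
Hypothesis ks0 : ks != [::].
Let S := map Q ks.
Let kappa := fine (Lambda (hits_hull S)).
Let S0 : S != [::]. Proof. by rewrite /S; case: ks ks0. Qed.
Let A := covering ks.
Let mA v : measurable (A v). Proof. exact: mcovering. Qed.
Let mhull : measurable (hits_hull S : set HH). Proof. exact: measurable_hits_hull. Qed.

Let kappa_ge0 : (0 <= kappa)%R. Proof. by rewrite fine_ge0. Qed.

(** The hyperplanes meeting the convex hull of S all meet the cell, whence the
    conditional probability that S is not separated. *)
Lemma nonseparation v w : A v w ->
  (0 <= kappa <= cell_rate (B v w))%R /\
  (fine (Lambda (~` hits_hull S `&` hits (B v w : set E))) / fine (Lambda (hits (B v w : set E))) =
  (cell_rate (B v w) - kappa) / cell_rate (B v w))%R.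
Proof.
move=> Aw; have cA := covers_cell_at S0 Aw.
have [cE rE] := cell_rateE cA.
have [[_ xc _] cW] := cell_convex_body W_compact W_convex W_interior cE.
have mhc : measurable (hits (B v w : set E) : set HH).
  by apply: measurable_hits_compact; exact: cell_compact cE.
have hfin : Lambda (hits (B v w : set E)) < +oo.
  apply: (le_lt_trans _ LW); apply: le_measure; [exact: mem_set|exact: mem_set|].
  by move=> H [x [Hx /cW Wx]]; exists x.
have hS : hits_hull S `<=` hits (B v w : set E) by move=> H; exact: covers_hull_sub xc Aw.
have kfin : Lambda (hits_hull S) < +oo.
  by apply: (le_lt_trans _ hfin); apply: le_measure => //; exact: mem_set.
split.
  by rewrite kappa_ge0 rE fine_le ?ge0_fin_numE//; apply: le_measure => //; exact: mem_set.
rewrite -rE; congr (_ / _)%R.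
rewrite setIC -setDE measureD// fineB ?ge0_fin_numE//; last first.
  by rewrite (setIidr hS).
by rewrite rE (setIidr hS).
Qed.

(** Exactly one child of v has S in its interior, unless the hyperplane of v separates
    S. *)
Lemma integral_children v (g : \bar R -> \bar R) : measurable_fun setT g ->
  (forall x, 0 <= g x) ->
  \int[P]_(w in A (true :: v)) g (birth_at (true :: v) w) +
  \int[P]_(w in A (false :: v)) g (birth_at (false :: v) w) =
  \int[P]_(w in A v `&` cut v @^-1` (~` hits_hull S)) g (birth_at v w + life v w).
Proof.
move=> mg g0; rewrite /birth_at /= -ge0_integral_setU//=.
- congr (integral _ _ _); apply/seteqP; split=> w.
    by move=> [] h; apply/(covers_child W_compact W_convex W_interior _ _ S0);
      [exists true|exists false].
  by move/(covers_child W_compact W_convex W_interior _ _ S0) => [[] h]; [left|right].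
- apply: measurable_funTS; apply: measurableT_comp => //.
  apply: emeasurable_funD; [exact: mbirth|exact: (measurable_life HY)].
- apply/disj_set2P; rewrite -subset0 => w [h1 h2].
  exact: (covers_child_unique S0 h1 h2).
Qed.

(** The function (lam - kappa) / lam, with values on the whole line making it
    measurable and non-negative. *)
Let rho (lam : R) : R :=
  if (0 < lam)%R then Num.max 0%R ((lam - kappa) * lam `^ (-1))%R else 0%R.

Let rho_ge0 lam : (0 <= rho lam)%R.
Proof. by rewrite /rho; case: ifP => // _; rewrite le_max lexx. Qed.

Let rhoE v w : A v w ->
  rho (cell_rate (B v w)) = ((cell_rate (B v w) - kappa) / cell_rate (B v w))%R.
Proof.
move=> /nonseparation[/andP[k0 kl] _]; rewrite /rho.
have := cell_rate_ge0 (B v w); rewrite le_eqVlt => /predU1P[<-|l0].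
  by rewrite ltxx invr0 mulr0.
rewrite l0 powR_inv1 ?ltW//; apply/max_idPr.
by rewrite divr_ge0 ?subr_ge0// ltW.
Qed.

Let mrho : measurable_fun setT rho.
Proof.
apply: measurable_fun_ifT => //; first exact: measurable_fun_ltr.
apply: measurable_maxr => //; apply: measurable_funM; first exact: measurable_funB.
exact: measurable_powR.
Qed.

Let mbl v : measurable_fun setT (fun w => birth_at v w + life v w).
Proof. by apply: emeasurable_funD; [exact: mbirth|exact: (measurable_life HY)]. Qed.

(** Given everything else, the hyperplane of v spares the convex hull of S with the
    conditional probability rho, so it can be integrated out.  The lifetime has to
    be finite for this, but otherwise the integrand vanishes. *)
Lemma integral_unseparated v :
  \int[P]_(w in A v `&` cut v @^-1` (~` hits_hull S))
    (survival kappa t (birth_at v w + life v w))%:E =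
  \int[P]_(w in A v)
    (survival kappa t (birth_at v w + life v w) * rho (cell_rate (B v w)))%:E.
Proof.
pose L := [set w | life v w < +oo].
have mL : measurable L.
  rewrite /L -[X in measurable X]setTI.
  by apply: emeasurable_fun_lt => //; exact: (measurable_life HY).
pose D := cut v @^-1` (~` hits_hull S).
have mD : measurable D.
  rewrite -[X in measurable X]setTI; apply: (measurable_cut HY) => //.
  exact: measurableC.
have survLoo w : ~ L w -> survival kappa t (birth_at v w + life v w) = 0%R.
  move=> /negP; rewrite -leNgt leye_eq => /eqP ->.
  have [->|bN] := eqVneq (birth_at v w) -oo; first by rewrite addNye survivalNy.
  by rewrite addey// survivaly.
transitivity (\int[P]_w ((survival kappa t (birth_at v w + life v w))%:E *
    (\1_(A v `&` L `&` D) w)%:E)).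
  rewrite integral_mkcond; apply: eq_integral => w _.
  rewrite epatch_indic/= !indicE.
  have [Lw|nLw] := pselect (L w); last by rewrite survLoo// !mul0e.
  congr (_ * (nat_of_bool _)%:R%:E).
  by apply/idP/idP => /set_mem h; apply/mem_set; move: h; rewrite /D/=; tauto.
transitivity (\int[P]_w ((survival kappa t (birth_at v w + life v w))%:E *
    (\1_(A v `&` L) w * rho (cell_rate (B v w)))%:E)); last first.
  rewrite [RHS]integral_mkcond; apply: eq_integral => w _.
  rewrite epatch_indic/= !indicE.
  have [Lw|nLw] := pselect (L w); last by rewrite survLoo// !mul0r !mul0e.
  have -> : (w \in A v `&` L) = (w \in A v).
    by apply/idP/idP => /set_mem h; apply/mem_set; move: h => /=; tauto.
  by rewrite -!EFinM; congr (_%:E); ring.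
have mrB : measurable_fun setT (fun w => rho (cell_rate (B v w))).
  apply: (measurableT_comp mrho); apply: measurableT_comp => //.
  exact: measurable_cell_rate.
apply: (@transfer_integral _ (\bar R) R _ _ Omega Omega P P
  (fun w => birth_at v w + life v w) (fun w => birth_at v w + life v w) _ _
  (EFin \o survival kappa t)) => //.
- by apply: measurable_indic; do 2 apply: measurableI => //.
- by apply: measurable_funM => //; apply: measurable_indic; exact: measurableI.
- by move=> w; rewrite mulr_ge0.
- move=> C mC; pose ZC := (fun w => birth_at v w + life v w) @^-1` C.
  have mZC : measurable ZC by rewrite -[X in measurable X]setTI; exact: mbl.
  have eA : elsewhere_or_life life cut v (A v `&` ZC).
    apply: (@measurableI _ (PastLife v)).
      by apply: (@sub_elsewhere_or_life v); exact: elsewhere_covers.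
    rewrite -[X in measurable X]setTI.
    suff : measurable_fun setT ((fun w => birth_at v w + life v w) : PastLife v -> \bar R).
      by move=> h; exact: h.
    apply: emeasurable_funD.
      move=> _ Y mY; apply: (@sub_elsewhere_or_life v).
      by have := @measurable_birth_elsewhere v measurableT Y mY.
    by move=> _ Y mY; apply: sub_sigma_algebra; right; exists Y.
  have := cut_law HY eA (measurableC mhull).
  rewrite (_ : _ `&` [set w | cell_at W cut v w] = A v `&` ZC); last first.
    by apply/setIidl => w [/(covers_cell_at S0)].
  rewrite -/L -/D => cl.
  rewrite integral_indic//; last by do 2 apply: measurableI => //.
  rewrite (_ : _ `&` ZC = A v `&` ZC `&` L `&` D); last first.
    by apply/seteqP; split=> w /=; rewrite /ZC/=; tauto.
  apply: (eq_trans cl).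
  rewrite -/ZC (integral_mkcond (A v `&` ZC `&` L)) (integral_mkcond ZC).
  apply: eq_integral => w _.
  rewrite !epatch_indic/= !indicE.
  have [Aw|nAw] := pselect (A v w); last first.
    rewrite memNset; last by move=> [[]].
    by rewrite (@memNset _ (A v `&` L)) ?mul0r ?mul0e ?mule0//; case.
  have [cE rE] := cell_rateE (covers_cell_at S0 Aw).
  rewrite cE (nonseparation Aw).2 -(rhoE Aw) -!EFinM [in RHS]mulrAC -natrM mulnb mulrC.
  congr ((nat_of_bool _)%:R * _)%:E.
  by apply/idP/andP => [/set_mem [[? ?] ?]|[/set_mem [? ?] /set_mem ?]];
    [split; apply/mem_set|apply/mem_set].
- by apply/measurable_EFinP; exact: measurable_survival.
- by move=> x; rewrite lee_fin survival_ge0.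
Qed.

Definition presence v : \bar R :=
  P (A v `&` [set w | alive t (birth_at v w, life v w)]).

Let surv v := \int[P]_(w in A v) (survival kappa t (birth_at v w))%:E.
Let disc v := \int[P]_(w in A v) (discount (birth_at v w))%:E.

Let msurv : measurable_fun setT (EFin \o survival kappa t).
Proof. by apply/measurable_EFinP; exact: measurable_survival. Qed.

Let mdisc : measurable_fun setT (EFin \o @discount R).
Proof. by apply/measurable_EFinP; exact: measurable_discount. Qed.

Let mpresent v : measurable [set w | alive t (birth_at v w, life v w)].
Proof.
rewrite -[X in measurable X]setTI.
have : measurable_fun setT (fun w => (birth_at v w, life v w)).
  by apply: measurable_fun_pair; [exact: mbirth|exact: (measurable_life HY)].
by move=> h; apply: h => //; exact: measurable_alive.
Qed.

(** This is [clock_survival] averaged over the cell v and its birth. *)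
Lemma survival_step v : surv v = presence v + (surv (true :: v) + surv (false :: v)).
Proof.
have surv0 x : 0 <= (EFin \o survival kappa t) x by rewrite lee_fin survival_ge0.
rewrite [X in _ + X](integral_children _ msurv surv0) [X in _ + X]integral_unseparated.
pose g (x : \bar R) (lam : R) (y : \bar R) : \bar R :=
  (\1_(alive t) (x, y) + survival kappa t (x + y) * rho lam)%:E.
have mg1 : measurable_fun setT (fun p : \bar R * R * \bar R => \1_(alive t) (p.1.1, p.2) : R).
  apply: (measurableT_comp (measurable_indic (@measurable_alive R t))).
  apply: measurable_fun_pair => //.
  exact: measurableT_comp.
have mg2 : measurable_fun setT (fun p : \bar R * R * \bar R =>
    (survival kappa t (p.1.1 + p.2) * rho p.1.2)%R).
  apply: measurable_funM.
    apply: (measurableT_comp (measurable_survival kappa t)).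
    apply: emeasurable_funD => //.
    exact: measurableT_comp.
  apply: (measurableT_comp mrho).
  exact: measurableT_comp.
have g20 x lam y : (0 <= survival kappa t (x + y) * rho lam)%R.
  by rewrite mulr_ge0 ?survival_ge0.
transitivity (\int[P]_(w in A v) g (birth_at v w) (cell_rate (B v w)) (life v w)).
  rewrite splitting_clock//; last 2 first.
  - by apply/measurable_EFinP; exact: measurable_funD.
  - by move=> x lam y; rewrite lee_fin addr_ge0.
  apply: eq_integral => w /set_mem Aw.
  have [kl _] := nonseparation Aw.
  rewrite (clock_survival _ _ kl) -(rhoE Aw) -ge0_integralD//.
  - apply/measurable_EFinP.
    apply: (measurableT_comp (measurable_indic (@measurable_alive R t))).
    by apply: measurable_fun_pair => //; exact: measurable_scaled_life.
  - by move=> y _; rewrite lee_fin.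
  - apply/measurable_EFinP; apply: measurable_funM => //.
    apply: (measurableT_comp (measurable_survival kappa t)).
    by apply: emeasurable_funD => //; exact: measurable_scaled_life.
have mZL : measurable_fun setT (fun w => (birth_at v w, cell_rate (B v w), life v w)).
  by apply: measurable_fun_pair; [exact: mbirth_rate|exact: (measurable_life HY)].
rewrite /g; under eq_integral do rewrite EFinD.
rewrite ge0_integralD//.
- congr (_ + _).
  rewrite /presence -[X in _ = P X]setIC -integral_indic//.
- by apply/measurable_EFinP/measurable_funTS; exact: (measurableT_comp mg1 mZL).
- by move=> w _; rewrite lee_fin.
- by apply/measurable_EFinP/measurable_funTS; exact: (measurableT_comp mg2 mZL).
Qed.

Let a0 : R := fine (Lambda (hits W)).
Let ratio : R := (a0 / (a0 + 1))%R.

Let a0_ge0 : (0 <= a0)%R. Proof. by rewrite fine_ge0. Qed.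

Let ratio_ge0 : (0 <= ratio)%R.
Proof. by rewrite divr_ge0// addr_ge0. Qed.

(** Dropping the condition that S not be separated, this is [clock_discount]
    averaged over the cell v and its birth. *)
Lemma discount_step v : disc (true :: v) + disc (false :: v) <= ratio%:E * disc v.
Proof.
have disc0 x : 0 <= (EFin \o @discount R) x by rewrite lee_fin discount_ge0.
rewrite (integral_children _ mdisc disc0).
have mbl' : measurable_fun setT (fun w => (discount (birth_at v w + life v w))%:E).
  exact: (measurableT_comp mdisc (mbl v)).
apply: (@le_trans _ _ (\int[P]_(w in A v) (discount (birth_at v w + life v w))%:E)).
  apply: ge0_subset_integral => //.
  - apply: measurableI => //; rewrite -[X in measurable X]setTI.
    by apply: (measurable_cut HY) => //; exact: measurableC.
  - exact: measurable_funTS.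
have := @splitting_clock ks v (fun x _ y => (discount (x + y))%:E) ks0.
move=> ->; last 2 first.
- apply: (measurableT_comp mdisc); apply: emeasurable_funD => //.
  exact: measurableT_comp.
- by move=> x _ y; exact: disc0.
rewrite -ge0_integralZl//; last 2 first.
- by apply: measurable_funTS; exact: (measurableT_comp mdisc (mbirth v)).
- by move=> w _; exact: disc0.
apply: ge0_le_integral => //.
- by move=> w _; apply: integral_ge0 => y _; exact: disc0.
- apply: measurable_funTS.
  have mh : measurable_fun setT (fun p : Omega * measurableTypeR R =>
      (discount (birth_at v p.1 + scaled_life (cell_rate (B v p.1)) p.2))%:E).
    apply: (measurableT_comp mdisc); apply: emeasurable_funD.
      by apply: (measurableT_comp (mbirth v)).
    apply: measurable_scaled_life => //.
    apply: (measurableT_comp measurable_cell_rate).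
    by apply: (measurableT_comp (mB v)).
  have := @measurable_fun_fubini_tonelli_F _ _ Omega (measurableTypeR R) R (exp1 R) _ mh.
  by apply=> p; exact: disc0.
- apply: measurable_funTS; apply: measurable_funeM.
  exact: (measurableT_comp mdisc (mbirth v)).
move=> w _; rewrite -EFinM mulrC; apply: clock_discount.
by rewrite cell_rate_ge0 cell_rate_le.
Qed.

Let surv_le_disc v : surv v <= (expR t)%:E * disc v.
Proof.
have disc0 x : 0 <= (EFin \o @discount R) x by rewrite lee_fin discount_ge0.
rewrite /disc -ge0_integralZl//; last 2 first.
- by apply: measurable_funTS; exact: (measurableT_comp mdisc (mbirth v)).
- by move=> w _; exact: disc0.
apply: ge0_le_integral => //.
- by move=> w _; rewrite lee_fin survival_ge0.
- by apply: measurable_funTS; exact: (measurableT_comp msurv (mbirth v)).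
- by apply: measurable_funTS; apply: measurable_funeM; exact: (measurableT_comp mdisc (mbirth v)).
move=> w _; rewrite -EFinM lee_fin.
case: (birth_at v w) => [r||]; last 2 first.
- by rewrite survivaly mulr_ge0 ?expR_ge0 ?discount_ge0.
- by rewrite survivalNy mulr_ge0 ?expR_ge0 ?discount_ge0.
rewrite survivalE discountE -expRD; case: ifPn => [rt|_]; last exact: expR_ge0.
rewrite ler_expR mulNr (@le_trans _ _ 0%R) ?subr_ge0// oppr_le0.
by rewrite mulr_ge0 ?subr_ge0.
Qed.

Lemma survival_words N : surv [::] =
  \sum_(v <- short_words N) presence v + \sum_(v <- words N) surv v.
Proof.
elim: N => [|N ->]; first by rewrite big_nil add0e /= big_seq1.
rewrite sum_words /= big_cat -addeA; congr (_ + _).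
by rewrite -big_split; apply: eq_bigr => v _; exact: survival_step.
Qed.

Lemma discount_words N : \sum_(v <- words N) disc v <= (ratio ^+ N)%:E.
Proof.
have disc_ge0 v : 0 <= disc v.
  by apply: integral_ge0 => w _; rewrite lee_fin discount_ge0.
elim: N => [|N ih].
  rewrite expr0 big_seq1 /disc /birth_at/= discountE oppr0 expR0 integral_cst// mul1e.
  exact: probability_le1.
rewrite sum_words exprS EFinM; apply: (@le_trans _ _ (ratio%:E * \sum_(v <- words N) disc v)).
  by rewrite ge0_sume_distrr//; apply: lee_sum => v _; exact: discount_step.
by apply: lee_pmul => //; exact: sume_ge0.
Qed.

Let presence_ge0 v : 0 <= presence v. Proof. exact: measure_ge0. Qed.

(** The partial sums differ from surv of the root by the contribution of generation
    N, at most exp t times the discounted one, which decreases geometrically. *)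
Lemma sum_presence : \esum_(v in [set: seq bool]) presence v = surv [::].
Proof.
apply/eqP; rewrite eq_le; apply/andP; split.
  apply: ub_ereal_sup => _ [X [finX _] <-].
  have [N XN] : exists N, X `<=` [set` short_words N].
    move/finite_seqP : finX => [s ->].
    exists (\max_(v <- s) size v).+1 => v vs.
    suff : v \in short_words (\max_(v <- s) size v).+1 by [].
    rewrite mem_short_words ltnS; exact: leq_bigmax_seq.
  rewrite (survival_words N); apply: (@le_trans _ _ (\sum_(v <- short_words N) presence v)).
    rewrite [leRHS]fsbig_seq ?short_words_uniq//.
    by apply: lee_fsum_nneg_subset => // v /set_mem/XN; exact: mem_set.
  rewrite leeDl//; apply: sume_ge0 => v _.
  by apply: integral_ge0 => w _; rewrite lee_fin survival_ge0.
suff h N : surv [::] <= \esum_(v in [set: seq bool]) presence v + (expR t * ratio ^+ N)%:E.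
  have cv : (\esum_(v in [set: seq bool]) presence v + (expR t * ratio ^+ N)%:E) @[N --> \oo]
      --> \esum_(v in [set: seq bool]) presence v.
    rewrite -[X in _ --> X]adde0; apply: cvgeD => //.
    - by rewrite fin_num_adde_defl.
    - exact: cvg_cst.
    apply: cvg_EFin; first by near=> N.
    rewrite -(mulr0 (expR t)); apply: cvgM; first exact: cvg_cst.
    apply: cvg_expr.
    by rewrite ger0_norm// /ratio ltr_pdivrMr ?mul1r ?ltrDl// ltr_wpDl.
  rewrite -(cvg_lim _ cv)//; apply: lime_ge; first by apply/cvg_ex; eexists; exact: cv.
  by apply: nearW.
rewrite {1}(survival_words N); apply: leeD.
  apply: esum_ge; exists [set` short_words N]; first by split => //; exact: finite_seq.
  by rewrite fsbig_seq ?short_words_uniq.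
apply: (@le_trans _ _ (\sum_(v <- words N) (expR t)%:E * disc v)).
  by apply: lee_sum => v _; exact: surv_le_disc.
rewrite -ge0_sume_distrr//; last first.
  by move=> v _; apply: integral_ge0 => w _; rewrite lee_fin discount_ge0.
rewrite EFinM; apply: lee_pmul => //; last exact: discount_words.
by apply: sume_ge0 => v _; apply: integral_ge0 => w _; rewrite lee_fin discount_ge0.
Unshelve. all: end_near. Qed.

Lemma presence_total : (0 <= t)%R -> \esum_(v in [set: seq bool]) presence v =
  if `[< covers S W >] then (expR (- kappa * t))%:E else 0.
Proof.
move=> t0; rewrite sum_presence /surv.
have AE w : A [::] w = covers S W by [].
case: asboolP => cSW.
  rewrite (_ : A [::] = setT); last by apply/seteqP; split=> w //= _; rewrite AE.
  transitivity (\int[P]_w cst (survival kappa t 0%:E)%:E w); first by [].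
  by rewrite integral_cst//= [X in _ * X]probability_setT mule1 survivalE subr0 t0.
by rewrite (_ : A [::] = set0) ?integral_set0//; apply/seteqP; split=> w //=; rewrite AE.
Qed.

End potentials.

End splitting_process.

Section splitting_cells.
Local Open Scope ereal_scope.
Variables (R : realType) (n : nat).
Local Notation E := 'rV[R]_n.+1.
Local Notation HH := (hyperplane R n).
Local Notation Q := (@rational_point R n).
Variables (Lambda : {measure set HH -> \bar R}) (W : set E).
Hypotheses (Lambda_lf : locally_finite Lambda)
  (W_compact : compact W) (W_convex : convex_set W)
  (W_interior : interior W !=set0).
Context d (Omega : measurableType d) (P : probability Omega R).
Variables (life : seq bool -> Omega -> \bar R) (cut : seq bool -> Omega -> HH).
Hypothesis HY : cell_splitting W P Lambda life cut.
Variable t : R.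
Hypothesis t0 : (0 <= t)%R.

Let W_closed : closed W := closed_W W_compact.

Let B v w := body W (cut^~ w) v.

Let mB v : measurable_fun setT (B v : Omega -> cell_space R n).
Proof. by apply: measurable_body => // u _ _; exact: (measurable_cut HY). Qed.

Let exists_at v := [set w | present W (life^~ w) (cut^~ w) t v].

Let cell_someP v w : cell_at W cut v w <-> exists k, interior (B v w) (Q k).
Proof.
rewrite /cell_at; split=> [|[k /body_interior_is_some -> //]].
rewrite /B /body; case cE : (cell W (cut^~ w) v) => [c|]//= _.
have [[_ _ ci] _] := cell_convex_body W_compact W_convex W_interior cE.
by apply: rational_point_dense => //; exact: open_interior.
Qed.

Let exists_atE v : exists_at v =
  \bigcup_k [set w | interior (B v w) (Q k)] `&`
  [set w | alive t (birth (life^~ w) v, life v w)].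
Proof.
apply/seteqP; split=> w.
  move=> [/cell_someP[k Bk] b1 b2]; split; first by exists k.
  by rewrite /alive/= b1.
by move=> [[k _ Bk] /andP[b1 b2]]; split => //; apply/cell_someP; exists k.
Qed.

Let measurable_exists_at v : measurable (exists_at v).
Proof.
rewrite exists_atE; apply: measurableI.
  apply: bigcup_measurable => k _; rewrite -[X in measurable X]setTI.
  exact: (mB v measurableT (@measurable_interior_at R n k)).
rewrite -[X in measurable X]setTI.
have h : measurable_fun setT (fun w => (birth (life^~ w) v, life v w)).
  apply: measurable_fun_pair; last exact: (measurable_life HY).
  by apply: measurable_birth => // u _ _; exact: (measurable_life HY).
exact: (h measurableT _ (@measurable_alive R t)).
Qed.

(** A cell that exists is a convex body, so its membership in the image of A can be
    tested on its trace. *)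
Lemma Y_intensityE (A : set (closed_subset W)) : <<s @open (closed_subset W) >> A ->
  Y_intensity P life cut t A =
  \esum_(v in [set: seq bool]) P (exists_at v `&` B v @^-1` (trace_cell W_closed @^-1` A)).
Proof.
move=> mA; pose F v := exists_at v `&` B v @^-1` (trace_cell W_closed @^-1` A).
have mF v : measurable (F v).
  apply: measurableI => //; rewrite -[X in measurable X]setTI.
  by apply: mB => //; exact: measurable_trace_cell.
rewrite esum_pickle//.
transitivity (\int[P]_w \sum_(0 <= i <oo)
    oapp (fun v => (\1_(F v) w)%:E) 0 (pickle_inv i : option (seq bool))); last first.
  rewrite integral_nneseries//.
  - apply: eq_eseriesr => i _; case: (pickle_inv i : option (seq bool)) => [v|]/=.
      by rewrite integral_indic// setIT.
    by rewrite integral0.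
  - move=> i; case: (pickle_inv i : option (seq bool)) => [v|]//=.
    by apply/measurable_EFinP; exact: measurable_indic.
  - by move=> i w _; case: (pickle_inv i : option (seq bool)) => //= v; rewrite lee_fin.
apply: eq_integral => w _; rewrite -esum_pickle; last by move=> v; rewrite lee_fin.
rewrite esum_mkcond; apply: eq_esum => v _; case: ifPn => [/set_mem pv|/negP nv]; last first.
  by rewrite indicE memNset// => -[pv _]; apply: nv; exact: mem_set.
have [cv _ _] := pv; rewrite /F /B /body !indicE; congr ((nat_of_bool _)%:R%:E).
move: cv; rewrite /cell_at; case cE : (cell W (cut^~ w) v) => [c|]//= _.
have [bc cW] := cell_convex_body W_compact W_convex W_interior cE.
have [cc _ _] := bc; have tP := trace_cellP W_closed A cc (convex_body_regular bc) cW.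
by apply/idP/idP => /set_mem h; apply/mem_set;
  [split => //=; rewrite cE; exact/tP|case: h => _; rewrite /= cE => /tP].
Qed.

Lemma Y_enumerated : enumerated W_closed P (Y_intensity P life cut t)
  (fun ks => if `[< covers (map Q ks) W >]
             then expR (- fine (Lambda (hits_hull (map Q ks))) * t) else 0%R).
Proof.
exists (fun i => oapp exists_at set0 (pickle_inv i : option (seq bool))).
exists (fun i => oapp B (cst set0) (pickle_inv i : option (seq bool))).
have E i A : P (oapp exists_at set0 (pickle_inv i : option (seq bool)) `&`
    oapp B (cst set0) (pickle_inv i : option (seq bool)) @^-1` A) =
    oapp (fun v => P (exists_at v `&` B v @^-1` A)) 0 (pickle_inv i : option (seq bool)).
  by case: (pickle_inv i : option (seq bool)) => //=; rewrite set0I.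
split.
- by move=> i; case: (pickle_inv i : option (seq bool)) => //= v; exact: measurable_exists_at.
- by move=> i; case: (pickle_inv i : option (seq bool)) => //= v; exact: mB.
- by move=> A mA; rewrite Y_intensityE// esum_pickle//; apply: eq_eseriesr => i _; rewrite E.
- move=> ks ks0; under eq_eseriesr do rewrite E.
  rewrite -esum_pickle// [RHS](fun_if EFin).
  rewrite -(presence_total Lambda_lf W_compact W_convex W_interior HY ks0 t0).
  apply: eq_esum => v _; rewrite /presence exists_atE.
  congr (P _); apply/seteqP; split=> w.
    by move=> [[_ a] c]; split => // _ /mapP[k kS ->]; exact: c.
  move=> [c a]; have cB k : k \in ks -> interior (B v w) (Q k).
    by move=> kS; apply: c; exact: map_f.
  split => //; split => //; case: (ks) ks0 cB => // k ks' _ /(_ k); rewrite mem_head => h.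
  by exists k => //; exact: h.
- by move=> i w; case: (pickle_inv i : option (seq bool)) => //= v [] /cell_someP.
Qed.

End splitting_cells.

(** * Complements of finitely many hyperplanes *)

Section hyperplane_components.
Variables (R : realType) (n : nat).
Local Notation E := 'rV[R]_n.+1.
Implicit Types (x y z : E) (A W : set E).

(** On a connected set disjoint from H the linear form of H avoids one value, hence
    stays on one side of it. *)
Lemma connected_nhits A (H : hyperplane R n) x y : connected A -> A x -> A y ->
  A `&` hset H = set0 -> ~ hits (segment x y) H.
Proof.
move=> cA Ax Ay AH; have [u [r pn]] := hyperplane_normal H.
move=> /(hits_segmentP _ _ pn) xy.
have /connected_intervalP iA : connected (dot u @` A).
  apply: connected_continuous_connected => //.
  by apply: continuous_subspaceT => z; exact: dot_continuous.
suff [z Az zr] : (dot u @` A) r.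
  by move: AH; rewrite -subset0 => /(_ z); apply; split => //; case: pn => _ ->.
have [h|h] := leP (dot u x) r.
  have [h'|h'] := leP r (dot u y).
    by apply: (iA (dot u x) (dot u y)); [exists x|exists y|rewrite h h'].
  apply: (iA (dot u x) (dot u x)); [by exists x|by exists x|].
  by rewrite h/=; nra.
have [h'|h'] := leP (dot u y) r.
  by apply: (iA (dot u y) (dot u x)); [exists y|exists x|rewrite h' ltW].
by exfalso; clear AH iA; nra.
Qed.

Section component.
Variables (W : set E) (Hs : set (hyperplane R n)).
Hypotheses (cW : closed W) (xW : convex_set W).
Let U := interior W `\` \bigcup_(H in Hs) hset H.

(** The interior of W is convex, so two of its points that no hyperplane separates
    are joined by a segment within U. *)
Lemma componentP x y : U x -> connected_component U x y <->
  interior W y /\ forall H, Hs H -> ~ hits (segment x y) H.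
Proof.
move=> Ux; split.
  move=> [A [Ax AU cA] Ay]; split; first by have [] := AU _ Ay.
  move=> H HH; apply: (connected_nhits cA) => //.
  by rewrite -subset0 => z [/AU[_ Uz] Hz]; apply: Uz; exists H.
move=> [Wy nH]; apply: (@connected_component_max _ _ (segment x y)) => //.
- exact: segment0.
- move=> z zxy; split; last by move=> [H HH Hz]; apply: (nH _ HH); exists z.
  have /convex_setP h := convex_interior xW.
  by apply: (h x y) => //; case: Ux.
- exact: connected_segment.
- exact: segment1.
Qed.

(** The component is contained in W and in a closed half-space of each hyperplane, so
    an interior point of its closure is interior to all these closed sets. *)
Lemma interior_closure_component_sub x : U x ->
  interior (closure (connected_component U x)) `<=` connected_component U x.
Proof.
move=> Ux z iz; apply/componentP => //; split.
  move: iz; apply: filterS; have -> : W = closure W by apply/closure_id.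
  apply: closure_subset => y /connected_component_sub[].
  by move=> /interior_subset.
move=> H HH; have [b xb] : exists b, interior (halfspace b H) x.
  by apply: side_exists => Hx; case: Ux => _; apply; exists H.
apply: (@side_nhits _ _ b) => //; move: iz; apply: filterS.
rewrite [X in _ `<=` X](_ : _ = closure (halfspace b H)); last first.
  by apply/closure_id; exact: halfspace_closed.
apply: closure_subset => y /componentP-/(_ Ux)[_ /(_ _ HH) xy].
by apply: interior_subset; exact: side_nhits_trans xb xy.
Qed.

Hypothesis finHs : finite_set (Hs `&` hits W).

Lemma component_open x : open (connected_component U x).
Proof.
have oU : open U.
  rewrite /U (_ : _ `\` _ = interior W `\` \bigcup_(H in Hs `&` hits W) hset H).
    rewrite setDE; apply: openI; first exact: open_interior.
    apply: closed_openC; apply: closed_bigcup => // H _.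
    by have -> : hset H = sval H :> set E by []; exact: closed_cset.
  apply/seteqP; split=> y [Wy nU]; split => // -[H HH Hy]; apply: nU; exists H => //.
    by case: HH.
  by split => //; exists y; split => //; exact: interior_subset.
rewrite openE => y xy; have Uy := connected_component_sub xy.
have := open_nbhs_nbhs (conj oU Uy) => /nbhs_ballP[e /= e0 He].
apply/nbhs_ballP; exists e => // z yz.
apply: connected_component_trans xy _.
apply: (@connected_component_max _ _ (segment y z)).
- exact: segment0.
- move=> _ [s /= s01 <-]; apply: He; move: yz; rewrite -!ball_normE/= => yz.
  rewrite opprD addrA subrr add0r normrN normrZ.
  move: s01; rewrite in_itv/= => /andP[s0 s1].
  by rewrite ger0_norm// -normrN opprB (le_lt_trans _ yz)// ler_piMl.
- exact: connected_segment.
- exact: segment1.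
Qed.

Lemma interior_closure_component x : U x ->
  interior (closure (connected_component U x)) = connected_component U x.
Proof.
move=> Ux; apply/seteqP; split; first exact: interior_closure_component_sub.
move=> y xy; apply: (@filterS _ _ _ (connected_component U x)).
  exact: subset_closure.
by apply: open_nbhs_nbhs; split => //; exact: component_open.
Qed.

End component.
End hyperplane_components.

(** * Cells of the Poisson hyperplane tessellation *)

Section integral_lemmas.
Import HBNNSimple.
Local Open Scope ereal_scope.
Context d (T : measurableType d) (R : realType).

Lemma le_integral_nonmeasurable (mu : {measure set T -> \bar R}) (f g : T -> \bar R) :
  (forall x, 0 <= f x) -> (forall x, f x <= g x) ->
  \int[mu]_x f x <= \int[mu]_x g x.
Proof.
move=> f0 fg; have g0 x : 0 <= g x by exact: le_trans (f0 x) (fg x).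
rewrite !ge0_integralTE//; apply: le_ereal_sup => _ [h hf <-].
by exists h => // x; exact: le_trans (hf x) (fg x).
Qed.

(** The integral is defined by the simple functions below the integrand, whose
    integrals ignore null sets.  This is needed because the number of cells is only
    controlled on the event that finitely many hyperplanes meet W. *)
Lemma ae_eq_integral_nonmeasurable (mu : {measure set T -> \bar R}) (N : set T)
    (f g : T -> \bar R) : measurable N -> mu (~` N) = 0 ->
  (forall x, 0 <= f x) -> (forall x, 0 <= g x) -> {in N, f =1 g} ->
  \int[mu]_x f x = \int[mu]_x g x.
Proof.
move=> mN N0 f0 g0 fg.
suff h k : (forall x, 0 <= k x) -> \int[mu]_x k x = \int[mu]_x (k \_ N) x.
  rewrite (h f)// (h g)//; apply: eq_integral => x _; rewrite !patchE.
  by case: ifP => // xN; rewrite fg.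
move=> k0; have kN0 x : 0 <= (k \_ N) x by rewrite patchE; case: ifP.
apply/eqP; rewrite eq_le; apply/andP; split; last first.
  by apply: le_integral_nonmeasurable => // x; rewrite patchE; case: ifP.
rewrite [leLHS]ge0_integralTE//; apply: ub_ereal_sup => _ [h hk <-].
rewrite -integralT_nnsfun (@ge0_negligible_integral _ _ _ mu _ (~` N))//; last 3 first.
- exact: measurableC.
- by apply/measurable_EFinP/measurable_funP.
- by move=> x _; rewrite lee_fin.
rewrite setTD setCK integral_mkcond; apply: le_integral_nonmeasurable => x.
  by rewrite patchE; case: ifP => //; rewrite lee_fin.
by rewrite !patchE; case: ifP.
Qed.

End integral_lemmas.

Section poisson_cells.
Local Open Scope ereal_scope.
Variables (R : realType) (n : nat).
Local Notation E := 'rV[R]_n.+1.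
Local Notation HH := (hyperplane R n).
Local Notation Q := (@rational_point R n).
Variables (Lambda : {measure set HH -> \bar R}) (W : set E).
Hypotheses (Lambda_lf : locally_finite Lambda)
  (W_compact : compact W) (W_convex : convex_set W).
Context d (Omega : measurableType d) (P : probability Omega R).
Variables (eta : Omega -> HH -> nat) (t : R).
Hypothesis t0 : (0 <= t)%R.
Hypothesis Heta : poisson_process P eta (fun B => t%:E * Lambda B).

Let W_closed : closed W := closed_W W_compact.

Let mhW : measurable (hits W : set HH). Proof. exact: measurable_hits_compact. Qed.
Let LW : Lambda (hits W) < +oo. Proof. exact: Lambda_lf. Qed.

Lemma npoints_eq0 (A : set HH) w :
  npoints eta A w = 0 <-> forall H, A H -> eta w H = 0%N.
Proof.
split => [h H AH|h]; last by apply: esum1 => H /h ->.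
have : (eta w H)%:R%:E <= npoints eta A w.
  apply: esum_ge; exists [set H]; first by split => // _ ->.
  by rewrite fsbig_set1.
by rewrite h lee_fin lern0 => /eqP.
Qed.

Let points w := [set H | (0 < eta w H)%N].

Lemma points_empty (A : set HH) w : npoints eta A w = 0 <-> forall H, points w H -> ~ A H.
Proof.
rewrite npoints_eq0; split => [h H Hw /h eH|h H AH].
  by move: Hw; rewrite /points/= eH.
by apply/eqP; rewrite -leqn0 leqNgt; apply/negP => /h.
Qed.

Let mnpoints0 (A : set HH) : measurable A -> measurable [set w | npoints eta A w = 0].
Proof.
move=> mA; rewrite -[X in measurable X]setTI.
exact: (measurable_npoints Heta mA measurableT (emeasurable_set1 0)).
Qed.

(** The event on which the cells of the Poisson tessellation are tame: it has
    probability 1 because Lambda [W] is finite. *)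
Definition finitely_many := [set w | npoints eta (hits W) w < +oo].

Lemma measurable_finitely_many : measurable finitely_many.
Proof.
rewrite /finitely_many -[X in measurable X]setTI.
by apply: emeasurable_fun_lt => //; exact: (measurable_npoints Heta).
Qed.

(** Infinitely many points would each contribute at least 1. *)
Lemma finite_points w : finitely_many w -> finite_set (points w `&` hits W).
Proof.
move=> fw; apply: contrapT => inf.
have big k : k%:R%:E <= npoints eta (hits W) w.
  have [X XA kX] := infinite_set_fset k inf.
  apply: esum_ge; exists [set` X]; first by split => // H /XA[].
  rewrite fsbig_finite// set_fsetK.
  apply: (@le_trans _ _ (\sum_(H <- X) (1%:E : \bar R))).
    by rewrite sumEFin lee_fin big_const_seq count_predT iter_addr_0 ler_nat.
  rewrite big_seq [leRHS]big_seq; apply: lee_sum => H /XA[Hw _].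
  by rewrite lee_fin ler1n.
move: fw; rewrite /finitely_many/= => fw.
have m0 : 0 <= npoints eta (hits W) w by apply: esum_ge0 => H _; rewrite lee_fin.
have := archi_boundP (fine_ge0 m0).
by rewrite ltNge -lee_fin fineK ?ge0_fin_numE// big.
Qed.

Let intensity_fin (A : set HH) : measurable A -> A `<=` hits W -> t%:E * Lambda A < +oo.
Proof.
move=> mA AW; apply: lte_mul_pinfty => //.
by apply: (le_lt_trans _ LW); apply: le_measure => //; exact: mem_set.
Qed.

Lemma finitely_many_prob1 : P finitely_many = 1.
Proof.
apply/eqP; rewrite eq_le probability_le1/=; last exact: measurable_finitely_many.
set r := fine (t%:E * Lambda (hits W)).
have m k : measurable [set w | npoints eta (hits W) w = k%:R%:E].
  rewrite -[X in measurable X]setTI.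
  exact: (measurable_npoints Heta mhW measurableT (emeasurable_set1 _)).
have tr : trivIset setT (fun k => [set w | npoints eta (hits W) w = k%:R%:E]).
  by apply/trivIsetP => i j _ _ ij; rewrite -subset0 => w [/= ->] [] /eqP;
    rewrite eqr_nat (negbTE ij).
rewrite (_ : 1 = P (\bigcup_k [set w | npoints eta (hits W) w = k%:R%:E])).
  apply: le_measure; [|exact: mem_set measurable_finitely_many|].
    by apply: mem_set; exact: bigcup_measurable.
  by move=> w [k _]; rewrite /finitely_many/= => ->; rewrite ltry.
rewrite measure_semi_bigcup//; last exact: bigcup_measurable.
rewrite -(probability_setT (poisson_prob r 0%N)).
rewrite (_ : [set: _] = \bigcup_k [set k]); last first.
  by apply/seteqP; split => // k _; exists k.
rewrite measure_semi_bigcup//; last first.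
  by apply/trivIsetP => i j _ _ ij; rewrite -subset0 => k [/= ->] /eqP; rewrite (negbTE ij).
apply: eq_eseriesr => k _; rewrite [RHS](npoints_poisson Heta)//.
exact: intensity_fin.
Qed.

Lemma infinitely_many_null : P (~` finitely_many) = 0.
Proof.
rewrite probability_setC ?finitely_many_prob1 ?subee//.
exact: measurable_finitely_many.
Qed.

Lemma void_prob (A : set HH) : measurable A -> A `<=` hits W ->
  P [set w | npoints eta A w = 0] = (expR (- fine (Lambda A) * t))%:E.
Proof.
move=> mA AW.
have LA : Lambda A \is a fin_num.
  rewrite ge0_fin_numE//.
  by apply: (le_lt_trans _ LW); apply: le_measure => //; exact: mem_set.
rewrite (npoints_poisson Heta 0%N mA (intensity_fin mA AW)) /poisson_prob fineM//=.
set a := fine (Lambda A); have a0 : (0 <= a)%R by rewrite fine_ge0.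
have := mulr_ge0 t0 a0; rewrite le_eqVlt => /predU1P[ta|ta].
  by rewrite -ta ltxx diracE mem_set// mulNr mulrC -ta oppr0 expR0.
rewrite ta esum_set1 ?lee_fin ?poisson_pmf_ge0 ?ltW//.
by rewrite /poisson_pmf ta expr0 fact0 divr1 mul1r mulNr mulrC.
Qed.

Let U w := interior W `\` \bigcup_(H in points w) hset H.
Let C w := connected_component (U w).

(** The points Q i and Q j lie in the same cell; see joinedP below. *)
Let joined i j := [set w | [/\ interior W (Q i), interior W (Q j) &
  forall H, points w H -> ~ hits (segment (Q i) (Q j)) H]].

Let measurable_joined i j : measurable (joined i j).
Proof.
have [Wi|nWi] := pselect (interior W (Q i)); last first.
  have -> : joined i j = set0.
    by apply/seteqP; split=> w []; move=> h _ _; exact: (nWi h).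
  exact: measurable0.
have [Wj|nWj] := pselect (interior W (Q j)); last first.
  have -> : joined i j = set0.
    by apply/seteqP; split=> w []; move=> _ h _; exact: (nWj h).
  exact: measurable0.
have -> : joined i j = [set w | npoints eta (hits (segment (Q i) (Q j))) w = 0].
  apply/seteqP; split=> w.
    by move=> [_ _ h]; apply/points_empty.
  by move=> /points_empty h; split.
by apply: mnpoints0; exact: measurable_hits_segment.
Qed.

Let U_nhits w x : U w x <-> interior W x /\ forall H, points w H -> ~ hset H x.
Proof.
split=> -[Wx h]; split => //; first by move=> H Hw Hx; apply: h; exists H.
by move=> [H Hw Hx]; exact: (h H).
Qed.

Let joinedP i j w : joined i j w <-> C w (Q i) (Q j).
Proof.
split=> [[Wi Wj h]|Cij].
  apply/componentP => //; apply/U_nhits; split => // H Hw Hi; apply: (h H Hw).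
  by exists (Q i); split => //; exact: segment0.
have Ui : U w (Q i).
  by apply: contrapT => /connected_component_out Ci; move: Cij; rewrite /C Ci.
have [Wj h] := (componentP W_convex (Q j) Ui).1 Cij.
by case: Ui => Wi _; exact: And3 Wi Wj h.
Qed.

(** Each cell is enumerated at the index of the first rational point in it. *)
Let label i := joined i i `\` \bigcup_(j in `I_i) joined j i.

Let measurable_label i : measurable (label i).
Proof. by apply: measurableD => //; exact: bigcup_measurable. Qed.

Let label_inj i j w : label i w -> label j w -> C w (Q i) = C w (Q j) -> i = j.
Proof.
wlog ij : i j / (i <= j)%N.
  move=> h li lj Cij; case: (leqP i j) => [ij|/ltnW ji]; first exact: h.
  by apply/esym/h.
move=> _ [/joinedP jj h] Cij; apply/eqP; rewrite eqn_leq ij leqNgt; apply/negP => ltij.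
by apply: h; exists i => //; apply/joinedP; rewrite Cij.
Qed.

Let label_exists w x : finitely_many w -> U w x ->
  exists2 i, label i w & C w x = C w (Q i).
Proof.
move=> fw Ux.
have : exists k, `[< C w x (Q k) >].
  have [||k Ck] := @rational_point_dense R n (C w x).
  - exact: (component_open (finite_points fw)).
  - by exists x; exact: connected_component_refl.
  by exists k; apply/asboolP.
move=> /ex_minnP[k /asboolP Ck mink]; exists k; last exact: same_connected_component.
have Ckk : C w (Q k) (Q k) by apply: connected_component_refl; exact: connected_component_sub Ck.
split; first exact/joinedP.
move=> [j /= jk /joinedP Cjk]; have /mink : `[< C w x (Q j) >]; last by rewrite leqNgt jk.
apply/asboolP; rewrite /C (same_connected_component Ck).
exact: connected_component_sym.
Qed.

(** The value off the event finitely_many makes pcell measurable: there the interiors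
    of the components are not controlled. *)
Let pcell i w : cell_space R n := if `[< finitely_many w >] then closure (C w (Q i)) else set0.

Let interior_pcell i w : finitely_many w -> interior (pcell i w) = C w (Q i).
Proof.
move=> fw; rewrite /pcell asboolT//.
have [Ui|nUi] := pselect (U w (Q i)).
  exact: (interior_closure_component W_closed W_convex (finite_points fw) Ui).
by rewrite /C connected_component_out// closure0 interior0.
Qed.

Let measurable_pcell i : measurable_fun setT (pcell i).
Proof.
apply: measurable_fun_cell_space => k.
rewrite (_ : [set w | _] = finitely_many `&` joined i k).
  by apply: measurableI => //; exact: measurable_finitely_many.
apply/seteqP; split=> w /=.
  have [fw|nfw] := pselect (finitely_many w).
    by rewrite interior_pcell// => /joinedP.
  by rewrite /pcell asboolF// interior0.
by move=> [fw /joinedP]; rewrite interior_pcell.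
Qed.

Let cell_event i := finitely_many `&` label i.

Let measurable_cell_event i : measurable (cell_event i).
Proof. by apply: measurableI => //; exact: measurable_finitely_many. Qed.

Let components_label w : finitely_many w ->
  set_bij [set i | label i w] (PHT_components eta W w) (fun i => C w (Q i)).
Proof.
move=> fw; split.
- by move=> i [/joinedP Ci _]; exists (Q i) => //; exact: connected_component_sub Ci.
- by move=> i j /set_mem li /set_mem lj; exact: label_inj.
- by move=> _ [x Ux <-]; have [i li] := label_exists fw Ux; rewrite /C => ->; exists i.
Qed.

Let pcell_regular i w : finitely_many w -> label i w ->
  [/\ closed (pcell i w), pcell i w `<=` closure (interior (pcell i w)) & pcell i w `<=` W].
Proof.
move=> fw li; rewrite interior_pcell// /pcell asboolT//; split => //.
- exact: closed_closure.
- rewrite closureE => x Wx; apply: Wx; split; first exact: W_closed.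
  by move=> y /connected_component_sub[+ _]; exact: interior_subset.
Qed.

(** On the event that finitely many hyperplanes meet W, the components are enumerated
    without repetition by their first rational points. *)
Lemma PHT_intensityE (B : set (closed_subset W)) :
    <<s @open (closed_subset W) >> B ->
  PHT_intensity P eta B =
  \sum_(0 <= i <oo) P (cell_event i `&` pcell i @^-1` (trace_cell W_closed @^-1` B)).
Proof.
move=> mB; pose F i := cell_event i `&` pcell i @^-1` (trace_cell W_closed @^-1` B).
have mF i : measurable (F i).
  apply: measurableI => //; rewrite -[X in measurable X]setTI.
  by apply: measurable_pcell => //; exact: measurable_trace_cell.
transitivity (\int[P]_w \sum_(0 <= i <oo) (\1_(F i) w)%:E); last first.
  rewrite integral_nneseries//; last by move=> i; apply/measurable_EFinP; exact: measurable_indic.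
  by apply: eq_eseriesr => i _; rewrite integral_indic// setIT.
apply: (ae_eq_integral_nonmeasurable measurable_finitely_many).
- exact: infinitely_many_null.
- by move=> w; apply: esum_ge0 => c _; rewrite lee_fin.
- by move=> w; apply: nneseries_ge0 => i _ _; rewrite lee_fin.
move=> w /set_mem fw; rewrite (@reindex_esum R _ _ _ _ _ _ (components_label fw)) esum_mkcond.
rewrite nneseries_esumT//; apply: eq_esum => i _.
case: ifPn => [/set_mem li|/negP nli]; last first.
  by rewrite indicE memNset// => -[[_ li] _]; apply: nli; exact: mem_set.
have [cl re sW] := pcell_regular fw li.
have cE : closure (C w (Q i)) = pcell i w by rewrite /pcell asboolT.
rewrite cE !indicE; congr ((nat_of_bool _)%:R%:E).
apply/idP/idP => /set_mem h; apply/mem_set.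
  by split; [split|exact/(trace_cellP W_closed B cl re sW)].
by case: h => _; move/(trace_cellP W_closed B cl re sW).
Qed.

Let joined_trans i j k w : joined i j w -> joined i k w -> joined j k w.
Proof.
move=> /joinedP Cij /joinedP Cik; apply/joinedP.
by rewrite /C -(same_connected_component Cij).
Qed.

(** At most one cell has the points of ks in its interior, and such a cell exists if
    and only if they are in the interior of W and no hyperplane of the process meets
    their convex hull. *)
Lemma pcell_total ks : ks != [::] ->
  \sum_(0 <= i <oo) P (cell_event i `&` pcell i @^-1` cylinder ks) =
  if `[< covers (map Q ks) W >]
  then (expR (- fine (Lambda (hits_hull (map Q ks))) * t))%:E else 0.
Proof.
case: ks => // k0 ks _; set S := k0 :: ks; pose F i := cell_event i `&` pcell i @^-1` cylinder S.
have mF i : measurable (F i).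
  apply: measurableI => //; rewrite -[X in measurable X]setTI.
  by apply: measurable_pcell => //; exact: measurable_cylinder.
have FE i w : F i w <-> [/\ finitely_many w, label i w & forall k, k \in S -> joined i k w].
  split=> [[[fw li] h]|[fw li h]]; split => //.
    by move=> k /h; rewrite interior_pcell// => /joinedP.
  by move=> k /h /joinedP; rewrite interior_pcell.
have k0S : k0 \in S by rewrite mem_head.
rewrite -measure_semi_bigcup//; last 2 first.
- apply/trivIsetP => i j _ _ /eqP ij; rewrite -subset0 => w [/FE[fw li hi] /FE[_ lj hj]].
  apply: ij; apply: label_inj li lj _.
  have /joinedP/same_connected_component := hi _ k0S.
  by have /joinedP/same_connected_component := hj _ k0S; rewrite -/(C w) => -> ->.
- by apply: bigcup_measurable => i _; exact: mF.
case: asboolP => cSW; last first.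
  rewrite (_ : \bigcup_i F i = set0) ?measure0//; apply/seteqP; split=> // w [i _ /FE[_ _ h]].
  by apply: cSW => _ /mapP[k kS ->]; have [] := h _ kS.
have hW : hits_hull (map Q S) `<=` hits W by move=> H; exact: covers_hull_sub.
rewrite -(void_prob (measurable_hits_hull _) hW).
rewrite (_ : \bigcup_i F i =
    [set w | npoints eta (hits_hull (map Q S)) w = 0] `&` finitely_many); last first.
  apply/seteqP; split=> [w [i _ /FE[fw li h]]|w [/points_empty hull0 fw]].
    split=> //; apply/points_empty => H Hw [_ [_ [/mapP[j jS ->] /mapP[k kS ->]]]].
    have [_ _ hjk] := joined_trans (h _ jS) (h _ kS).
    exact: hjk.
  have jS j k : j \in S -> k \in S -> joined j k w.
    move=> jS kS; split; [exact/cSW/map_f|exact/cSW/map_f|] => H Hw jk; apply: (hull0 H Hw).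
    by exists (Q j), (Q k); split => //; exact: map_f.
  have Uk0 : U w (Q k0) by have /joinedP/connected_component_sub := jS _ _ k0S k0S.
  have [i li Ci] := label_exists fw Uk0; exists i => //; apply/FE; split => // k kS.
  by apply/joinedP; rewrite -Ci; apply/joinedP; exact: jS.
have mhull := mnpoints0 (measurable_hits_hull (map Q S)).
rewrite [RHS](measureDI _ mhull measurable_finitely_many).
rewrite [X in _ = X + _](_ : _ = 0) ?add0e//.
have mNc := measurableC measurable_finitely_many.
apply: (subset_measure0 _ mNc (@subIsetr _ _ _) infinitely_many_null).
exact: measurableI.
Qed.

Lemma pcell_nonempty i w : cell_event i w -> exists k, interior (pcell i w) (Q k).
Proof. by move=> [fw [/joinedP Ci _]]; exists i; rewrite interior_pcell. Qed.

Lemma PHT_enumerated : enumerated W_closed P (@PHT_intensity R n _ _ P eta W)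
  (fun ks => if `[< covers (map Q ks) W >]
             then expR (- fine (Lambda (hits_hull (map Q ks))) * t) else 0%R).
Proof.
exists cell_event, pcell; split => //.
- exact: PHT_intensityE.
- by move=> ks /pcell_total ->; case: asboolP.
- exact: pcell_nonempty.
Qed.

End poisson_cells.

(** * Equality of the intensity measures *)

Theorem theorem1 (R : realType) (n : nat) (hn : (2 <= n.+1)%N)
  (Lambda : {measure set (hyperplane R n) -> \bar R})
  (Lambda_na : non_atomic Lambda) (Lambda_lf : locally_finite Lambda)
  (W : set 'rV[R]_n.+1)
  (W_compact : compact W) (W_convex : convex_set W)
  (W_volume : (0 < volume W)%E)
  (t : R) (t_gt0 : 0 < t)
  (d1 : measure_display) (Omega1 : measurableType d1)
  (P1 : probability Omega1 R)
  (life : seq bool -> Omega1 -> \bar R)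
  (cut : seq bool -> Omega1 -> hyperplane R n)
  (HY : cell_splitting W P1 Lambda life cut)
  (d2 : measure_display) (Omega2 : measurableType d2)
  (P2 : probability Omega2 R)
  (eta : Omega2 -> hyperplane R n -> nat)
  (Heta : poisson_process P2 eta (fun B => t%:E * Lambda B)%E) :
  forall B : set (closed_subset W), <<s @open (closed_subset W) >> B ->
    Y_intensity P1 life cut t B = PHT_intensity P2 eta B.
Proof.
have W_interior := positive_volume_interior W_compact W_convex W_volume.
exact: (enumerated_unique
  (Y_enumerated Lambda_lf W_compact W_convex W_interior HY (ltW t_gt0))
  (PHT_enumerated Lambda_lf W_compact W_convex (ltW t_gt0) Heta)).
Qed.
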